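(* Let $E\subseteq\mathbb{Z}$ and $1\le p<\infty$. (i) Suppose $p$ is an even integer. Then the following are equivalent: $E$ is a real metric unconditional basic sequence (umbs) in $L^p(\mathbb{T})$; $E$ is a complex umbs in $L^p(\mathbb{T})$; $E$ enjoys property $(\mathcal{I}_{p/2})$. If $(\mathcal{I}_{p/2})$ holds, there is in fact a finite $G\subseteq E$ such that $E\setminus G$ is a $1$-unconditional basic sequence in $L^p(\mathbb{T})$. (ii) If $p$ is not an even integer and $E$ is a real or complex umbs in $L^p(\mathbb{T})$, then $E$ enjoys $(\mathcal{I}_\infty)$.
   Context: $\mathbb{T}=\{z\in\mathbb{C}:|z|=1\}$ with normalized Haar measure; $e_n(z)=z^n$. The choice of signs is $\mathbb{S}=\mathbb{T}$ in the complex case and $\mathbb{S}=\{-1,1\}$ in the real case. The complex (resp. real) unconditionality constant of $E\subseteq\mathbb{Z}$ in $X$ is the infimum of the $C$ such that $\|\sum_{q\in G}\epsilon_q a_q e_q\|_X\le C\|\sum_{q\in G}a_qe_q\|_X$ for all finite $G\subseteq E$, $a_q\in\mathbb{C}$, $\epsilon_q\in\mathbb{S}$. $E$ is a complex (resp. real) $1$-unconditional basic sequence in $X$ if $C=1$ works. $E$ is a complex (resp. real) metric unconditional basic sequence (umbs) in $X$ if for each $\varepsilon>0$ there is a finite set $F$ such that the complex (resp. real) unconditionality constant of $E\setminus F$ is less than $1+\varepsilon$. ''$1$-unconditional basic sequence'' without qualification means complex (hence also real). Let $\mathrm{Z}^m=\{\zeta\in(\mathbb{Z}\setminus\{0\})^m:\zeta_1+\dots+\zeta_m=0\}$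 and $\mathrm{Z}^m_n=\{\zeta\in\mathrm{Z}^m:|\zeta_1|+\dots+|\zeta_m|\le 2n\}$. $E$ enjoys $(\mathcal{I}_n)$ (almost $n$-independence) if there is a finite $G\subseteq E$ such that $\zeta_1r_1+\dots+\zeta_mr_m\ne0$ for all $m\ge 1$, all $\zeta\in\mathrm{Z}_n^m$ and all distinct $r_1,\dots,r_m\in E\setminus G$. $E$ enjoys $(\mathcal{I}_\infty)$ if it enjoys $(\mathcal{I}_n)$ for all $n\ge1$. *)

(* Defs.v *)
From HB Require Import structures.
From mathcomp Require Import all_boot all_order all_algebra.
From mathcomp Require Import finmap.
From mathcomp Require Import complex.
From mathcomp Require Import all_classical all_reals all_analysis.

Set Implicit Arguments.
Unset Strict Implicit.
Unset Printing Implicit Defensive.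

Import Order.TTheory GRing.Theory Num.Theory.
Local Open Scope classical_set_scope.
Local Open Scope ring_scope.
Local Open Scope complex_scope.

Definition char_circle (R : realType) (n : int) : R[i] -> R[i] := fun z => z ^ n.

Definition trig_poly (R : realType) (G : {fset int}) (a : int -> R[i]) :
    R[i] -> R[i] :=
  fun z => \sum_(q <- G) a q * char_circle q z.

Definition circle_param (R : realType) (t : R) : R[i] :=
  cos (2 * pi * t) +i* sin (2 * pi * t).

(* The normalized Haar measure of the circle is the image under [circle_param]
   of the uniform probability on [0, 1], so the L^p norm is computed by pulling
   the modulus of the function back to [0, 1]. *)
Definition Lp_circle (R : realType) (p : R) (f : R[i] -> R[i]) : \bar R :=
  Lnorm (uniform_prob (@ltr01 R)) p%:E
    (fun t : R => (ComplexField.Normc.normc (f (circle_param t)))%:E).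

Definition complex_signs (R : realType) : set R[i] := [set z | `|z| = 1].

Definition real_signs (R : realType) : set R[i] := [set z | z = 1 \/ z = -1].

(* [normX] is the norm of a space X of functions on the circle, and S is the
   choice of signs. *)
Definition uncond_bound (R : realType) (normX : (R[i] -> R[i]) -> \bar R)
    (S : set R[i]) (E : set int) (C : R) : Prop :=
  forall (G : {fset int}) (a eps : int -> R[i]),
    [set` G] `<=` E -> (forall q, q \in G -> S (eps q)) ->
    (normX (trig_poly G (fun q => (eps q * a q)%R))
       <= C%:E * normX (trig_poly G a))%E.

(* The infimum is +oo if no C works; for empty E every real C works and it
   is -oo. *)
Definition uncond_const (R : realType) (normX : (R[i] -> R[i]) -> \bar R)
    (S : set R[i]) (E : set int) : \bar R :=
  ereal_inf [set C%:E | C in uncond_bound normX S E].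

Definition one_uncond (R : realType) (normX : (R[i] -> R[i]) -> \bar R)
    (S : set R[i]) (E : set int) : Prop :=
  uncond_bound normX S E 1.

(* Metric unconditional basic sequence. *)
Definition umbs (R : realType) (normX : (R[i] -> R[i]) -> \bar R)
    (S : set R[i]) (E : set int) : Prop :=
  forall eps : R, 0 < eps ->
    exists F : {fset int},
      (uncond_const normX S (E `\` [set` F]) < (1 + eps)%:E)%E.

Definition zero_sum (m : nat) : set ('I_m -> int) :=
  [set zeta | (forall i, zeta i != 0) /\ \sum_i zeta i = 0].

Definition zero_sum_le (n m : nat) : set ('I_m -> int) :=
  [set zeta | zero_sum zeta /\ (\sum_i `|zeta i| <= 2 * n)%N].

Definition almost_indep (n : nat) (E : set int) : Prop :=
  exists2 G : {fset int}, [set` G] `<=` E &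
    forall (m : nat) (zeta r : 'I_m -> int), (1 <= m)%N ->
      zero_sum_le n zeta -> injective r -> (forall i, (E `\` [set` G]) (r i)) ->
      \sum_i zeta i * r i != 0.

Definition almost_indep_infty (E : set int) : Prop :=
  forall n : nat, (1 <= n)%N -> almost_indep n E.

(* Main.v *)
Require Import Defs.
From mathcomp Require Import all_boot all_order all_algebra finmap complex.
From mathcomp Require Import all_classical all_reals all_analysis.
From mathcomp Require Import measurable_realfun ring lra zify.

(* Idea for the necessity of (I_n), after Neuwirth.  Let [zeta . r = 0] be a
   relation with an odd coefficient [zeta_j]; pick [i0 <> j] and perturb:
   compare [|1 + rho sum_i om_i u_i|^p], where [u_i = e_(r_i - r_i0)], with the
   same expression after [u_j] is replaced by [- u_j].  Averaging over roots of
   unity [om_i] against [prod_i om_i^(-zeta_i)] kills, in the expansion of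
   [|1 + w|^p = |(1 + w)^(p/2)|^2] in powers of [w] and its conjugate, every
   monomial but those proportional to [prod_i u_i^zeta_i].  What remains is
   [prod_i u_i^zeta_i (c rho^d + O(rho^(d+1)))] with [d = sum_i |zeta_i|] and
   [c] a nonzero multiple of two binomial coefficients of [p/2], which vanish
   only if [p] is an even integer that is too small.  The relation makes the
   product equal to [1], and the change of sign turns it into [-1]: for a fixed
   small [rho] this forbids unconditionality constants close to 1, uniformly in
   [r].  Only finitely many [zeta] are concerned, and dividing a relation by 2
   makes a coefficient odd.

   For [p = 2k], expanding [|f|^(2k)] and integrating keeps the pairs of
   [k]-tuples of frequencies with the same sum; under (I_k) these are
   permutations of each other, so the norm depends only on the moduli of the
   coefficients. *)

Set Implicit Arguments.
Unset Strict Implicit.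
Unset Printing Implicit Defensive.

Import Order.TTheory GRing.Theory Num.Theory.
Import numFieldNormedType.Exports.
Local Open Scope classical_set_scope.
Local Open Scope ring_scope.
Local Open Scope complex_scope.

Local Notation normc := ComplexField.Normc.normc.

(** * Binomial series *)

Definition gbinom (R : realType) (h : R) (n : nat) : R :=
  (\prod_(l < n) (h - l%:R)) / n`!%:R.

Lemma gbinom_rec (R : realType) (h : R) (n : nat) :
  n.+1%:R * gbinom h n.+1 = (h - n%:R) * gbinom h n.
Proof.
rewrite /gbinom big_ord_recr /= factS natrM.
have n0 : (n.+1%:R : R) != 0 by rewrite pnatr_eq0.
have f0 : (n`!%:R : R) != 0 by rewrite pnatr_eq0 -lt0n fact_gt0.
by field; apply/andP; split; rewrite ?f0 // -?natrD ?add1n ?addn1 ?n0.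
Qed.

Lemma gbinom_neq0 (R : realType) (h : R) (n : nat) :
  (forall l, (l < n)%N -> h != l%:R) -> gbinom h n != 0.
Proof.
move=> hl; rewrite mulf_neq0// ?invr_neq0// ?pnatr_eq0 -?lt0n ?fact_gt0//.
by apply/prodf_neq0 => l _; rewrite subr_eq0 hl.
Qed.

Section taylor_along_a_ray.
Context {R : realType} (h c s : R).

(** Real and imaginary parts of the truncated binomial series of [(1 + w)^h] at [w = x (c + i s)],
    kept as two real polynomials in [x] so that the real mean value theorem applies. *)
Definition ray_re (N : nat) : {poly R} :=
  \sum_(a < N.+1) (gbinom h a * complex.Re ((c +i* s) ^+ a)) *: 'X^a.
Definition ray_im (N : nat) : {poly R} :=
  \sum_(a < N.+1) (gbinom h a * complex.Im ((c +i* s) ^+ a)) *: 'X^a.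

Lemma ray_Re_exprS (a : nat) : complex.Re ((c +i* s) ^+ a.+1) =
  c * complex.Re ((c +i* s) ^+ a) - s * complex.Im ((c +i* s) ^+ a).
Proof. by rewrite exprS; case: (_ ^+ a). Qed.

Lemma ray_Im_exprS (a : nat) : complex.Im ((c +i* s) ^+ a.+1) =
  c * complex.Im ((c +i* s) ^+ a) + s * complex.Re ((c +i* s) ^+ a).
Proof. by rewrite exprS; case: (_ ^+ a) => x y /=; ring. Qed.

Lemma horner_ray_reS (N : nat) (x : R) : (ray_re N.+1).[x] =
  (ray_re N).[x] + gbinom h N.+1 * complex.Re ((c +i* s) ^+ N.+1) * x ^+ N.+1.
Proof. by rewrite /ray_re big_ord_recr /= hornerD hornerZ hornerXn. Qed.

Lemma horner_ray_imS (N : nat) (x : R) : (ray_im N.+1).[x] =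
  (ray_im N).[x] + gbinom h N.+1 * complex.Im ((c +i* s) ^+ N.+1) * x ^+ N.+1.
Proof. by rewrite /ray_im big_ord_recr /= hornerD hornerZ hornerXn. Qed.

Lemma horner_deriv_ray_reS (N : nat) (x : R) : (ray_re N.+1)^`().[x] =
  (ray_re N)^`().[x]
    + gbinom h N.+1 * complex.Re ((c +i* s) ^+ N.+1) * (N.+1%:R * x ^+ N).
Proof.
rewrite /ray_re big_ord_recr /= derivD hornerD derivZ derivXn hornerZ.
by rewrite hornerMn hornerXn mulr_natl.
Qed.

Lemma horner_deriv_ray_imS (N : nat) (x : R) : (ray_im N.+1)^`().[x] =
  (ray_im N)^`().[x]
    + gbinom h N.+1 * complex.Im ((c +i* s) ^+ N.+1) * (N.+1%:R * x ^+ N).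
Proof.
rewrite /ray_im big_ord_recr /= derivD hornerD derivZ derivXn hornerZ.
by rewrite hornerMn hornerXn mulr_natl.
Qed.

Lemma ray0 (x : R) : ((ray_re 0).[x] = 1) * ((ray_im 0).[x] = 0) *
  ((ray_re 0)^`().[x] = 0) * ((ray_im 0)^`().[x] = 0).
Proof.
have g0 : gbinom h 0 = 1 by rewrite /gbinom big_ord0 fact0 divr1.
rewrite /ray_re /ray_im !big_ord1 !expr0 g0 /= mulr1 mulr0 scale0r.
by rewrite scale1r derivC linear0 !hornerE.
Qed.

(* Real and imaginary parts of the differential equation
   [(1 + v X) P' - h v P = (N - h) binom(h, N) v^(N+1) X^N] satisfied by the
   truncation [P] of the binomial series of [(1 + v X)^h], [v = c + i s]. *)
Lemma ray_ode_re (N : nat) (x : R) :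
  (1 + c * x) * (ray_re N)^`().[x] - s * x * (ray_im N)^`().[x]
    - h * (c * (ray_re N).[x] - s * (ray_im N).[x])
  = (N%:R - h) * gbinom h N * complex.Re ((c +i* s) ^+ N.+1) * x ^+ N.
Proof.
elim: N => [|N IH].
  by rewrite !ray0 /gbinom big_ord0 fact0 divr1 /= expr0; ring.
have /eqP := gbinom_rec h N; rewrite -subr_eq0 => /eqP E.
move/eqP: IH; rewrite -subr_eq0 => /eqP IH.
rewrite horner_ray_reS horner_ray_imS horner_deriv_ray_reS horner_deriv_ray_imS.
rewrite (ray_Re_exprS N.+1).
set u := (ray_re N).[x] in IH *; set v := (ray_im N).[x] in IH *.
set u' := (ray_re N)^`().[x] in IH *; set v' := (ray_im N)^`().[x] in IH *.
set a := complex.Re _ in IH *; set b := complex.Im _.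
(* Goal minus induction hypothesis is [a x^N] times the recurrence of the binomial coefficients;
   this is a ring identity. *)
apply/eqP; rewrite -subr_eq0 -[X in _ == X](mulr0 (a * x ^+ N)) -E.
rewrite -[X in X == _]subr0 -IH.
by rewrite -[N.+1]addn1 natrD !exprD !expr1; apply/eqP; ring.
Qed.

Lemma ray_ode_im (N : nat) (x : R) :
  (1 + c * x) * (ray_im N)^`().[x] + s * x * (ray_re N)^`().[x]
    - h * (c * (ray_im N).[x] + s * (ray_re N).[x])
  = (N%:R - h) * gbinom h N * complex.Im ((c +i* s) ^+ N.+1) * x ^+ N.
Proof.
elim: N => [|N IH].
  by rewrite !ray0 /gbinom big_ord0 fact0 divr1 /= expr0; ring.
have /eqP := gbinom_rec h N; rewrite -subr_eq0 => /eqP E.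
move/eqP: IH; rewrite -subr_eq0 => /eqP IH.
rewrite horner_ray_reS horner_ray_imS horner_deriv_ray_reS horner_deriv_ray_imS.
rewrite (ray_Im_exprS N.+1).
set u := (ray_re N).[x] in IH *; set v := (ray_im N).[x] in IH *.
set u' := (ray_re N)^`().[x] in IH *; set v' := (ray_im N)^`().[x] in IH *.
set a := complex.Re _; set b := complex.Im _ in IH *.
apply/eqP; rewrite -subr_eq0 -[X in _ == X](mulr0 (b * x ^+ N)) -E.
rewrite -[X in X == _]subr0 -IH.
by rewrite -[N.+1]addn1 natrD !exprD !expr1; apply/eqP; ring.
Qed.

End taylor_along_a_ray.

Lemma unit_circle_expr (R : realType) (c s : R) (a : nat) :
  c ^+ 2 + s ^+ 2 = 1 ->
  `|complex.Re ((c +i* s) ^+ a)| <= 1 /\ `|complex.Im ((c +i* s) ^+ a)| <= 1.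
Proof.
move=> cs.
have : complex.Re ((c +i* s) ^+ a) ^+ 2 + complex.Im ((c +i* s) ^+ a) ^+ 2 = 1.
  elim: a => [|a IH]; first by rewrite expr0 /= expr1n expr0n addr0.
  by rewrite ray_Re_exprS ray_Im_exprS -[RHS]mulr1 -{1}cs -{1}IH; ring.
move: (complex.Re _) (complex.Im _) => x y xy.
by split; rewrite ler_norml; apply/andP; split; nra.
Qed.

Lemma horner_ray_bound (R : realType) (h c s x : R) (N : nat) :
  c ^+ 2 + s ^+ 2 = 1 -> 0 <= x <= 1 ->
  let S := \sum_(a < N.+1) `|gbinom h a| in
  `|(ray_re h c s N).[x]| <= S /\ `|(ray_im h c s N).[x]| <= S.
Proof.
move=> cs /andP[x0 x1] S; split; rewrite horner_sum;
  apply: (le_trans (ler_norm_sum _ _ _)); apply: ler_sum => a _;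
  rewrite hornerZ hornerXn !normrM -mulrA ler_piMr//;
  have [? ?] := unit_circle_expr a cs;
  by rewrite mulr_ile1// ger0_norm ?exprn_ge0// exprn_ile1.
Qed.

Lemma horner_ray0 (R : realType) (h c s : R) (N : nat) :
  (ray_re h c s N).[0] = 1 /\ (ray_im h c s N).[0] = 0.
Proof.
elim: N => [|N [IH1 IH2]]; first by rewrite !ray0.
by rewrite horner_ray_reS horner_ray_imS IH1 IH2 expr0n !mulr0 !addr0.
Qed.

(** Let [P = U + i V] be the truncation and [B = |1 + v x|^2]. The function [F = |P|^2 B^(-h)]
    equals 1 at 0, and the differential equation of [P] puts a factor [x^N] in its derivative. The
    mean value theorem bounds [F(x) - 1], and multiplying by [B^h] gives the estimate, uniformly in
    the direction [v]. The restriction [x <= 1/2] keeps [B] between 1/4 and 9/4. *)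
Lemma taylor_along_ray (R : realType) (h : R) (N : nat) : 0 <= h ->
  exists2 C, 0 <= C & forall c s x : R, c ^+ 2 + s ^+ 2 = 1 -> 0 <= x <= 2^-1 ->
  `|((1 + c * x) ^+ 2 + (s * x) ^+ 2) `^ h
    - ((ray_re h c s N).[x] ^+ 2 + (ray_im h c s N).[x] ^+ 2)| <= C * x ^+ N.+1.
Proof.
move=> h0.
pose S : R := \sum_(a < N.+1) `|gbinom h a|.
pose K : R := `|(N%:R - h) * gbinom h N|.
pose C1 : R := (4^-1 `^ (h + 1))^-1.
have S0 : 0 <= S by apply: sumr_ge0 => *; exact: normr_ge0.
have C10 : 0 <= C1 by rewrite invr_ge0 powR_ge0.
(* [(9/4)^h] bounds [B^h] and [C1] bounds [B^(-h-1)]. In [8 S K], one factor 2 is that of [dF], one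
   counts its two terms, and one is [3/2 + 1/2], the bounds of [|1 + c y|] and [|s y|]. *)
exists ((9 / 4) `^ h * (C1 * (8 * S * K))).
  rewrite !mulr_ge0 ?powR_ge0 ?normr_ge0 ?ler0n//.
move=> c s x cs /andP[x0 x2].
have c1 : `|c| <= 1 by have [] := unit_circle_expr 1 cs.
have s1 : `|s| <= 1 by have [] := unit_circle_expr 1 cs.
set U := ray_re h c s N; set V := ray_im h c s N.
pose B : {poly R} := (1 + c *: 'X) ^+ 2 + (s *: 'X) ^+ 2.
have BE y : B.[y] = (1 + c * y) ^+ 2 + (s * y) ^+ 2 by rewrite /B !hornerE.
have BE' y : B^`().[y] = 2 * ((1 + c * y) * c + s ^+ 2 * y).
  by rewrite /B !expr2 !poly.derivE !hornerE /=; ring.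
have Bb (y : R) : 0 <= y <= 2^-1 -> 4^-1 <= B.[y] <= 9 / 4.
  move=> /andP[y0 y1]; rewrite BE.
  move: c1 s1; rewrite !ler_norml => /andP[? ?] /andP[? ?].
  by apply/andP; split; nra.
pose A : {poly R} := U ^+ 2 + V ^+ 2.
pose F (y : R) := A.[y] * B.[y] `^ (- h).
pose r1 (y : R) := (N%:R - h) * gbinom h N * complex.Re ((c +i* s) ^+ N.+1) * y ^+ N.
pose r2 (y : R) := (N%:R - h) * gbinom h N * complex.Im ((c +i* s) ^+ N.+1) * y ^+ N.
(* This is [B^(-h-1) (A' B - h A B')] after substitution of the differential equation: the terms in
   [h] cancel and only the remainder [r1 + i r2] is left. *)
pose dF (y : R) := B.[y] `^ (- h - 1) *
  (2 * (U.[y] * ((1 + c * y) * r1 y + s * y * r2 y)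
      + V.[y] * ((1 + c * y) * r2 y - s * y * r1 y))).
have dFP (y : R) : 0 <= y <= 2^-1 -> is_derive y (1 : R) F (dF y).
  move=> y01; have /andP[B0 _] := Bb _ y01.
  have {}B0 : 0 < B.[y] by apply: lt_le_trans B0; rewrite invr_gt0.
  have H1 := is_derive1_powR (- h) B0.
  have H2 := is_derive1_comp H1 (is_derive_poly B y).
  have H3 := is_deriveM (is_derive_poly A y) H2.
  apply: (is_derive_eq H3); rewrite /= /GRing.scale /=.
  rewrite /dF /r1 /r2 -(ray_ode_re h c s N y) -(ray_ode_im h c s N y) -/U -/V.
  have -> : B.[y] `^ (- h) = B.[y] `^ (- h - 1) * B.[y].
    by rewrite -{3}[B.[y]]powRr1 ?ltW// -powRD ?subrK// lt0r_neq0// implybT.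

  rewrite BE' BE /A derivD !expr2 !derivM !hornerD !hornerM.
  by ring.
have /(_ x0) [||y /[!in_itv]/= /andP[y0 yx]] := @MVT_segment _ F dF 0 x.
- move=> y /[!in_itv]/= /andP[y0 yx]; apply: dFP.
  by rewrite (ltW y0) (le_trans (ltW yx)).
- apply: derivable_within_continuous => y /[!in_itv]/= /andP[y0 yx].
  by apply: ex_derive; apply: dFP; rewrite y0 (le_trans yx).
rewrite subr0 => FE.
have [U0 V0] := horner_ray0 h c s N.
have F0 : F 0 = 1.
  by rewrite /F BE !mulr0 addr0 /A !hornerE U0 V0 !expr1n expr0n !addr0 powR1 mulr1.
have y2 : 0 <= y <= 2^-1 by rewrite y0 (le_trans yx).
have yN : y ^+ N <= x ^+ N by apply: lerXn2r; rewrite ?nnegrE.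
have yN0 : 0 <= y ^+ N by rewrite exprn_ge0.
have [Re1 Im1] := unit_circle_expr N.+1 cs.
have r1b : `|r1 y| <= K * x ^+ N.
  rewrite /r1 -mulrA normrM ler_wpM2l// normrM (ger0_norm yN0).
  by rewrite -[leRHS]mul1r ler_pM.
have r2b : `|r2 y| <= K * x ^+ N.
  rewrite /r2 -mulrA normrM ler_wpM2l// normrM (ger0_norm yN0).
  by rewrite -[leRHS]mul1r ler_pM.
have y1 : 0 <= y <= 1 by rewrite y0 (le_trans (andP y2).2)// invf_le1 ?ler1n.
have [Ub Vb] : `|U.[y]| <= S /\ `|V.[y]| <= S by exact: horner_ray_bound.
have a1 : `|1 + c * y| <= 3 / 2.
  move: c1 (y2); rewrite !ler_norml => /andP[? ?] /andP[? ?].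
  by apply/andP; split; nra.
have a2 : `|s * y| <= 1 / 2.
  move: s1 (y2); rewrite !ler_norml => /andP[? ?] /andP[? ?].
  by apply/andP; split; nra.
have KN0 : 0 <= K * x ^+ N by rewrite mulr_ge0 ?normr_ge0 ?exprn_ge0.
have p1 : `|(1 + c * y) * r1 y + s * y * r2 y| <= 2 * (K * x ^+ N).
  apply: (le_trans (ler_normD _ _)).
  rewrite (normrM _ (r1 y)) (normrM _ (r2 y)).
  have := ler_pM (normr_ge0 _) (normr_ge0 _) a1 r1b.
  have := ler_pM (normr_ge0 _) (normr_ge0 _) a2 r2b.
  by lra.
have p2 : `|(1 + c * y) * r2 y - s * y * r1 y| <= 2 * (K * x ^+ N).
  apply: (le_trans (ler_normB _ _)).
  rewrite (normrM _ (r1 y)) (normrM _ (r2 y)).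
  have := ler_pM (normr_ge0 _) (normr_ge0 _) a1 r2b.
  have := ler_pM (normr_ge0 _) (normr_ge0 _) a2 r1b.
  by lra.
have Bh : B.[y] `^ (- h - 1) <= C1.
  rewrite -opprD powRN lef_pV2 ?posrE ?powR_gt0 ?invr_gt0//.
    have /andP[B4 _] := Bb _ y2; apply: ge0_ler_powR => //.
    - by rewrite addr_ge0.
    - by rewrite nnegrE invr_ge0.
    - by rewrite nnegrE (le_trans _ B4)// invr_ge0.
  by have /andP[B4 _] := Bb _ y2; rewrite (lt_le_trans _ B4)// invr_gt0.
have dFb : `|dF y| <= C1 * (8 * S * K) * x ^+ N.
  rewrite /dF normrM -(mulrA C1); apply: ler_pM => //.
    by rewrite ger0_norm ?powR_ge0.
  rewrite normrM (ger0_norm (ler0n _ _)).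
  have := ler_pM (normr_ge0 _) (normr_ge0 _) Ub p1.
  have := ler_pM (normr_ge0 _) (normr_ge0 _) Vb p2.
  rewrite -!normrM => q1 q2.
  apply: (le_trans (ler_wpM2l _ (ler_normD _ _))) => //.
  have -> : 8 * S * K * x ^+ N = 2 * (2 * (S * (2 * (K * x ^+ N)))) by ring.
  by rewrite ler_pM2l// [leRHS]mulr_natl mulr2n lerD.
have x01 : 0 <= x <= 2^-1 by rewrite x0.
have /andP[Bx4 Bx9] := Bb _ x01.
have Bx0 : 0 < B.[x] by rewrite (lt_le_trans _ Bx4)// invr_gt0.
have AE : U.[x] ^+ 2 + V.[x] ^+ 2 = B.[x] `^ h * F x.
  rewrite /F mulrCA -powRD ?subrr ?powRr0 ?mulr1; last by rewrite lt0r_neq0// implybT.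
  by rewrite /A hornerD !horner_exp.
rewrite F0 in FE.
rewrite -BE AE -[X in `|X - _|]mulr1 -mulrBr normrM distrC FE.
rewrite ger0_norm ?powR_ge0// -(mulrA ((9 / 4) `^ h)); apply: ler_pM => //.
- by rewrite powR_ge0.
- apply: ge0_ler_powR => //; rewrite nnegrE.
    exact: ltW.
  exact: divr_ge0.
by rewrite normrM (ger0_norm x0) exprSr mulrA ler_wpM2r.
Qed.

(** * Points of the circle *)

Lemma normc_sqr (R : realType) (z : R[i]) :
  normc z ^+ 2 = complex.Re z ^+ 2 + complex.Im z ^+ 2.
Proof. by case: z => x y /=; rewrite sqr_sqrtr// addr_ge0 ?sqr_ge0. Qed.

Lemma normc_ge0 (R : realType) (z : R[i]) : 0 <= normc z.
Proof. by case: z => x y /=; rewrite sqrtr_ge0. Qed.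

Lemma normc_powR_half (R : realType) (h : R) (z : R[i]) :
  normc z `^ (2 * h) = (complex.Re z ^+ 2 + complex.Im z ^+ 2) `^ h.
Proof. by rewrite powRrM -normc_sqr powR_mulrn ?normc_ge0. Qed.

Lemma normcX (R : realType) (z : R[i]) (n : nat) : normc (z ^+ n) = normc z ^+ n.
Proof.
elim: n => [|n IH]; first by rewrite !expr0 ComplexField.Normc.normc1.
by rewrite !exprS ComplexField.Normc.normcM IH.
Qed.

Lemma polar_decomposition (R : realType) (w : R[i]) :
  exists c s : R, c ^+ 2 + s ^+ 2 = 1 /\ w = (normc w)%:C * (c +i* s).
Proof.
have [->|w0] := eqVneq w 0.
  exists 1, 0; rewrite ComplexField.Normc.normc0 expr1n expr0n addr0; split=> //.
  by rewrite mul0r.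
have n0 : normc w != 0.
  by apply: contra w0 => /eqP/ComplexField.Normc.eq0_normc ->.
exists (complex.Re w / normc w), (complex.Im w / normc w); split.
  by rewrite !expr_div_n -mulrDl -normc_sqr divff ?expf_neq0.
case: w n0 {w0} => x y n0; set n := normc _ in n0 *.
by apply/eqP; rewrite eq_complex /= !mul0r subr0 addr0 ![n * _]mulrC !divfK ?eqxx.
Qed.

Definition gbinom_series (R : realType) (h : R) (N : nat) (w : R[i]) : R[i] :=
  \sum_(a < N.+1) (gbinom h a)%:C * w ^+ a.

(** Polar coordinates reduce this to the ray estimate, whose constant does not depend on the
    direction. *)
Lemma taylor_normc (R : realType) (h : R) (N : nat) : 0 <= h ->
  exists2 C, 0 <= C & forall w : R[i], normc w <= 2^-1 ->
  `|normc (1 + w) `^ (2 * h) - normc (gbinom_series h N w) ^+ 2|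
    <= C * normc w ^+ N.+1.
Proof.
move=> h0; have [C C0 HC] := taylor_along_ray N h0.
exists C => // w wle; have [c [s [cs wE]]] := polar_decomposition w.
set x := normc w in wE wle *.
have x0 : 0 <= x by exact: normc_ge0.
have := HC c s x cs; rewrite x0 wle => /(_ isT).
rewrite normc_powR_half normc_sqr.
have PE : gbinom_series h N w = (ray_re h c s N).[x] +i* (ray_im h c s N).[x].
  rewrite /gbinom_series /ray_re /ray_im !horner_sum.
  have sumE n (f g : 'I_n -> R) :
      (\sum_(i < n) f i) +i* (\sum_(i < n) g i) = \sum_(i < n) (f i +i* g i).
    elim: n f g => [|n IH] f g; first by rewrite !big_ord0.
    by rewrite !big_ord_recr /= -IH.
  rewrite sumE; apply: eq_bigr => a _.
  rewrite wE exprMn -rmorphXn mulrCA mulrA -rmorphM /=.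
  rewrite !hornerZ !hornerXn; move: ((c +i* s) ^+ a) => -[y z] /=.
  by apply/eqP; rewrite eq_complex /=; apply/andP; split; apply/eqP; ring.
by rewrite PE wE /= !mul0r subr0 addr0 add0r (mulrC c) (mulrC s).
Qed.

Section circle_param_theory.
Context {R : realType}.
Implicit Types (s t : R) (n : int).

Lemma normc_circle_param t : normc (circle_param t) = 1.
Proof. by rewrite /circle_param /= cos2Dsin2 sqrtr1. Qed.

Lemma circle_paramD s t :
  circle_param (s + t) = circle_param s * circle_param t.
Proof.
rewrite /circle_param mulrDr cosD sinD; apply/eqP; rewrite eq_complex /= eqxx /=.
by rewrite addrC mulrC (mulrC (sin _)).
Qed.

Lemma circle_param0 : circle_param (0 : R) = 1.
Proof. by rewrite /circle_param mulr0 cos0 sin0. Qed.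

Lemma circle_param1 : circle_param (1 : R) = 1.
Proof. by rewrite /circle_param mulr1 mulr_natl cos2pi sin2pi. Qed.

Lemma circle_param_neq0 t : circle_param t != 0.
Proof.
apply/eqP => t0; have := normc_circle_param t.
by rewrite t0 ComplexField.Normc.normc0 => /eqP; rewrite eq_sym oner_eq0.
Qed.

Lemma circle_paramN t : circle_param (- t) = (circle_param t)^-1.
Proof.
apply: (mulfI (circle_param_neq0 t)).
by rewrite -circle_paramD subrr circle_param0 divff ?circle_param_neq0.
Qed.

Lemma circle_paramXn t (k : nat) : circle_param t ^+ k = circle_param (t * k%:R).
Proof.
elim: k => [|k IH]; first by rewrite expr0 mulr0 circle_param0.
by rewrite exprSr IH -circle_paramD -[k.+1]addn1 natrD mulrDr mulr1.
Qed.

Lemma circle_paramXz t n : circle_param t ^ n = circle_param (t * n%:~R).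
Proof.
case: n => k; first by rewrite -exprnP circle_paramXn.
rewrite -[LHS]/((circle_param t ^+ k.+1)^-1) circle_paramXn -circle_paramN.
by rewrite NegzE mulrNz mulrN.
Qed.

Lemma circle_param_int n : circle_param (n%:~R : R) = 1.
Proof. by rewrite -[n%:~R]mul1r -circle_paramXz circle_param1 exp1rz. Qed.

(** By the double angle formula, [cos (2 pi t) = 1] forces [sin (pi t) = 0], while the sine is
    positive on the open interval from 0 to [pi]. *)
Lemma circle_param_neq1 t : 0 < `|t| < 1 -> circle_param t != 1.
Proof.
move=> /andP[t0 t1]; apply/eqP => -[ct _].
have tE : 2 * pi * t = (pi * t) *+ 2 by rewrite -mulrA mulr_natl.
move: ct; rewrite tE cos_mulr2n => ct.
have st : sin (pi * t) ^+ 2 = 0.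
  by have := cos2Dsin2 (pi * t); lra.
have : 0 < sin (pi * `|t|).
  by apply: sin_gt0_pi; rewrite mulr_gt0 ?pi_gt0//= gtr_pMr ?pi_gt0.
move/eqP: st; rewrite expf_eq0 /= => /eqP st.
case: (ger0P t) => _; first by rewrite st ltxx.
by rewrite mulrN sinN st oppr0 ltxx.
Qed.

(** A geometric sum of ratio [xi] with [xi^M = 1]; the bound [|j| < M] makes [xi] different from 1
    unless [j = 0]. *)
Lemma sum_roots_of_unity (M : nat) (j : int) : (0 < M)%N -> (`|j| < M)%N ->
  \sum_(k < M) circle_param (k%:R / M%:R : R) ^ j = if j == 0 then M%:R else 0.
Proof.
move=> M0 jM; have [->|j0] := eqVneq j 0.
  under eq_bigr do rewrite expr0z.
  by rewrite big_const_ord iter_addr_0.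
have MR : (M%:R : R) != 0 by rewrite pnatr_eq0 -lt0n.
set xi := circle_param (j%:~R / M%:R : R).
have E k : circle_param (k%:R / M%:R : R) ^ j = xi ^+ k.
  by rewrite circle_paramXz circle_paramXn; congr circle_param; ring.
under eq_bigr do rewrite E.
have xi1 : xi != 1.
  apply: circle_param_neq1; rewrite normrM normfV normr_nat -intr_norm.
  rewrite divr_gt0 ?ltr0n ?ltr0z ?absz_gt0 ?normr_gt0//=.
  rewrite ltr_pdivrMr ?ltr0n// mul1r -[M%:R]mulrz_nat ltr_int.
  by rewrite natz -abszE ltz_nat.
have xi0 : xi - 1 != 0 by rewrite subr_eq0.
apply: (mulfI xi0).
by rewrite -subrX1 mulr0 circle_paramXn divfK// circle_param_int subrr.
Qed.

End circle_param_theory.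

(** * Averages over roots of unity *)

Section multiplicity.
Context {I : finType}.

(** Powers of sums are expanded over words [phi] instead of exponent vectors: every word has
    coefficient 1, so that no multinomial coefficient appears. *)
Definition mult (a : nat) (phi : {ffun 'I_a -> I}) (i : I) : nat :=
  (\sum_(l < a) (phi l == i))%N.

Lemma sum_mult (a : nat) (phi : {ffun 'I_a -> I}) : (\sum_i mult phi i = a)%N.
Proof.
rewrite exchange_big /= -[RHS](card_ord a) -sum1_card.
apply: eq_bigr => l _; rewrite (bigD1 (phi l))//= eqxx big1 ?addn0// => i.
by rewrite eq_sym => /negPf ->.
Qed.

Lemma leq_mult (a : nat) (phi : {ffun 'I_a -> I}) (i : I) : (mult phi i <= a)%N.
Proof. by rewrite -[leqRHS](sum_mult phi) (bigD1 i)//= leq_addr. Qed.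

Lemma mult_surj (f : I -> nat) (a : nat) : (\sum_i f i = a)%N ->
  exists phi : {ffun 'I_a -> I}, mult phi =1 f.
Proof.
(* The word made of [f i] copies of each letter [i]. *)
pose s := flatten [seq nseq (f i) i | i <- enum I].
have sf i : count_mem i s = f i.
  rewrite count_flatten -map_comp sumnE big_map big_enum /= (bigD1 i)//=.
  rewrite count_nseq /= eqxx mul1n big1 ?addn0// => j ji.
  by rewrite count_nseq /= (negPf ji) mul0n.
have -> : (\sum_i f i = size s)%N.
  rewrite size_flatten /shape -map_comp sumnE big_map big_enum /=.
  by apply: eq_bigr => i _; rewrite size_nseq.
move=> <-; exists [ffun l => tnth (in_tuple s) l] => i.
transitivity (count_mem i (map (tnth (in_tuple s)) (enum 'I_(size s))));
  last by rewrite map_tnth_enum sf.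
rewrite count_map.
rewrite -sum1_count big_enum_cond /= /mult [RHS]big_mkcond /=.
by apply: eq_bigr => l _; rewrite ffunE; case: (_ == i).
Qed.

Lemma prod_mult (K : comPzRingType) (x : I -> K) (a : nat)
    (phi : {ffun 'I_a -> I}) :
  \prod_(l < a) x (phi l) = \prod_i x i ^+ mult phi i.
Proof.
under [RHS]eq_bigr do rewrite -prodrXr.
rewrite exchange_big /=; apply: eq_bigr => l _.
rewrite (bigD1 (phi l))//= eqxx expr1 big1 ?mulr1// => i.
by rewrite eq_sym => /negPf ->.
Qed.

Lemma exp_sum_mult (K : comNzRingType) (x : I -> K) (a : nat) :
  (\sum_i x i) ^+ a = \sum_(phi : {ffun 'I_a -> I}) \prod_i x i ^+ mult phi i.
Proof.
rewrite -[in LHS](card_ord a) -prodr_const bigA_distr_bigA /=.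
by apply: eq_bigr => phi _; rewrite prod_mult.
Qed.

Lemma exp_sum_mult2 (K : fieldType) (x : I -> K) (a b : nat) :
  (forall i, x i != 0) ->
  (\sum_i x i) ^+ a * (\sum_i (x i)^-1) ^+ b =
  \sum_(phi : {ffun 'I_a -> I}) \sum_(psi : {ffun 'I_b -> I})
    \prod_i x i ^ ((mult phi i)%:Z - (mult psi i)%:Z).
Proof.
move=> x0; rewrite !exp_sum_mult mulr_suml; apply: eq_bigr => phi _.
rewrite mulr_sumr; apply: eq_bigr => psi _.
rewrite -big_split /=; apply: eq_bigr => i _.
by rewrite expfzDr// exprnP -exprz_inv.
Qed.

End multiplicity.

Lemma unimodular_neq0 (R : realType) (z : R[i]) : normc z = 1 -> z != 0.
Proof.
move=> z1; apply/eqP => z0; move/eqP: z1.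
by rewrite z0 ComplexField.Normc.normc0 eq_sym oner_eq0.
Qed.

Lemma mul_conj_normc (R : realType) (z : R[i]) : z * conjc z = (normc z ^+ 2)%:C.
Proof.
rewrite normc_sqr; case: z => x y /=; apply/eqP; rewrite eq_complex /=.
by apply/andP; split; apply/eqP; ring.
Qed.

Lemma unimodular_conj (R : realType) (z : R[i]) : normc z = 1 -> conjc z = z^-1.
Proof.
move=> z1; apply: (mulfI (unimodular_neq0 z1)).
by rewrite mul_conj_normc z1 expr1n divff ?unimodular_neq0.
Qed.

Lemma normc_prod (R : realType) (I : finType) (x : I -> R[i]) :
  normc (\prod_i x i) = \prod_i normc (x i).
Proof.
apply: (big_morph (@ComplexField.Normc.normc R)).
  exact: ComplexField.Normc.normcM.
exact: ComplexField.Normc.normc1.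
Qed.

Lemma normc_sum_le (R : realType) (I : finType) (x : I -> R[i]) :
  normc (\sum_i x i) <= \sum_i normc (x i).
Proof.
apply: (big_ind2 (fun z y => normc z <= y)) => //.
  by rewrite ComplexField.Normc.normc0.
move=> z1 y1 z2 y2 h1 h2; apply: le_trans (lerD h1 h2).
exact: le_normcD.
Qed.

Lemma normcXz (R : realType) (z : R[i]) (n : int) : normc (z ^ n) = normc z ^ n.
Proof.
case: n => n; first exact: normcX.
by rewrite -[z ^ _]/((z ^+ n.+1)^-1) ComplexField.Normc.normcV normcX.
Qed.

Lemma ler_norm_Re_normc (R : realType) (z : R[i]) :
  `|complex.Re z| <= normc z.
Proof. by case: z => x y /=; rewrite -sqrtr_sqr ler_wsqrtr// lerDl sqr_ge0. Qed.

Section root_of_unity_average.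
Context {R : realType} {I : finType} (gamma : I -> int) (M : nat).

(** One [M]-th root of unity for each index: summing over [k] is a finite substitute for integrating
    over a torus. *)
Definition root_pt (k : {ffun I -> 'I_M}) (i : I) : R[i] :=
  circle_param ((k i)%:R / M%:R).

Definition root_wt (k : {ffun I -> 'I_M}) : R[i] :=
  \prod_i root_pt k i ^ (- gamma i).

(** The coefficient of [prod_i u_i^gamma_i] in [(sum_i u_i)^a (sum_i u_i^-1)^b], the [u_i] being
    independent variables. *)
Definition num_relations (a b : nat) : nat :=
  (\sum_(phi : {ffun 'I_a -> I}) \sum_(psi : {ffun 'I_b -> I})
    [forall i, ((mult phi i)%:Z - (mult psi i)%:Z == gamma i)%R])%N.

(** The sum over [k] factors into one sum over roots of unity per index. The bound by [M] rules out
    aliasing, so a factor vanishes as soon as [n i] differs from [gamma i]. *)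
Lemma root_wt_average (n : I -> int) (u : I -> R[i]) :
  (0 < M)%N -> (forall i, `|n i - gamma i| < M)%N -> (forall i, normc (u i) = 1) ->
  \sum_k root_wt k * \prod_i (root_pt k i * u i) ^ n i =
  if [forall i, n i == gamma i] then M%:R ^+ #|I| * \prod_i u i ^ gamma i else 0.
Proof.
move=> M0 nM u1.
have E k : root_wt k * \prod_i (root_pt k i * u i) ^ n i =
    (\prod_i circle_param ((k i)%:R / M%:R : R) ^ (n i - gamma i))
      * \prod_i u i ^ n i.
  rewrite -!big_split /=; apply: eq_bigr => i _.
  rewrite expfzMl mulrA -expfzDr ?circle_param_neq0//.
  by rewrite [- _ + _]addrC.
rewrite (eq_bigr _ (fun k _ => E k)) -mulr_suml -(bigA_distr_bigA
  (fun i (k : 'I_M) => circle_param (k%:R / M%:R : R) ^ (n i - gamma i))).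
case: ifPn => [/forallP ng|].
  rewrite (eq_bigr (fun=> M%:R)); last first.
    by move=> i _; rewrite sum_roots_of_unity// subr_eq0 (eqP (ng i)) eqxx.
  rewrite prodr_const; congr (_ * _).
  by apply: eq_bigr => i _; rewrite (eqP (ng i)).
rewrite negb_forall => /existsP[i ni].
by rewrite (bigD1 i)//= sum_roots_of_unity// subr_eq0 (negPf ni) !mul0r.
Qed.

Lemma root_average_monomial (u : I -> R[i]) (a b : nat) (rho : R) :
  (0 < M)%N -> (forall i, a + b + `|gamma i| < M)%N -> (forall i, normc (u i) = 1) ->
  \sum_k root_wt k * ((rho%:C * \sum_i (root_pt k i * u i)) ^+ a
                    * conjc (rho%:C * \sum_i (root_pt k i * u i)) ^+ b)
  = (rho ^+ (a + b) * (M%:R ^+ #|I| * (num_relations a b)%:R))%:C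
      * \prod_i u i ^ gamma i.
Proof.
move=> M0 gM u1.
have x0 k i : root_pt k i * u i != 0.
  by rewrite mulf_neq0 ?circle_param_neq0 ?unimodular_neq0.
have conjE k : conjc (rho%:C * \sum_i (root_pt k i * u i))
    = rho%:C * \sum_i (root_pt k i * u i)^-1.
  rewrite rmorphM rmorph_sum; congr (_ * _); first by rewrite /= oppr0.
  apply: eq_bigr => i _.
  apply: unimodular_conj.
  by rewrite ComplexField.Normc.normcM normc_circle_param u1 mulr1.
have E k : root_wt k * ((rho%:C * \sum_i (root_pt k i * u i)) ^+ a
                    * conjc (rho%:C * \sum_i (root_pt k i * u i)) ^+ b)
    = rho%:C ^+ (a + b) * (root_wt k *
      \sum_(phi : {ffun 'I_a -> I}) \sum_(psi : {ffun 'I_b -> I})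
        \prod_i (root_pt k i * u i) ^ ((mult phi i)%:Z - (mult psi i)%:Z)).
  by rewrite conjE !exprMn mulrACA -exprD exp_sum_mult2// mulrCA.
rewrite (eq_bigr _ (fun k _ => E k)) -mulr_sumr rmorphM rmorphXn -mulrA; congr (_ * _).
transitivity (\sum_(phi : {ffun 'I_a -> I}) \sum_(psi : {ffun 'I_b -> I})
    if [forall i, (mult phi i)%:Z - (mult psi i)%:Z == gamma i]
    then M%:R ^+ #|I| * \prod_i u i ^ gamma i else 0 : R[i]).
  under [LHS]eq_bigr do rewrite mulr_sumr.
  rewrite exchange_big /=; apply: eq_bigr => phi _.
  under [LHS]eq_bigr do rewrite mulr_sumr.
  rewrite exchange_big /=; apply: eq_bigr => psi _.
  apply: root_wt_average => // i.
  (* The exponent [mult phi i - mult psi i] lies between [-b] and [a]. *)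
  have := leq_mult phi i; have := leq_mult psi i; have := gM i; lia.
rewrite rmorphM rmorphXn /= !rmorph_nat mulrAC.
set X := _ * \prod_i _; rewrite natr_sum mulr_sumr; apply: eq_bigr => phi _.
rewrite natr_sum mulr_sumr; apply: eq_bigr => psi _.
by case: ifP; rewrite ?mulr1 ?mulr0.
Qed.

End root_of_unity_average.

(** * Leading term of the averaged binomial series *)

Section obstruction.
Context {R : realType} {I : finType} (gamma : I -> int).

Definition pos_mult (i : I) : nat := if 0 <= gamma i then `|gamma i|%N else 0%N.
Definition neg_mult (i : I) : nat := if 0 <= gamma i then 0%N else `|gamma i|%N.

Lemma pos_neg_mult (i : I) : gamma i = (pos_mult i)%:Z - (neg_mult i)%:Z.
Proof. by rewrite /pos_mult /neg_mult; case: ifP => ?; lia. Qed.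

Lemma abs_gamma (i : I) : `|gamma i|%N = (pos_mult i + neg_mult i)%N.
Proof. by rewrite /pos_mult /neg_mult; case: ifP => ?; lia. Qed.

(** If two words of lengths [a] and [b] realize [gamma], then [a - b] is the sum of [gamma], and
    [|gamma i| <= mult phi i + mult psi i] gives [a + b >= sum_i |gamma i|]. With the assumed
    converse inequality, both the sum and the difference of [a] and [b] are determined. *)
Lemma num_relations_eq0 (a b : nat) :
  (a + b <= \sum_i `|gamma i|)%N ->
  (a, b) != (\sum_i pos_mult i, \sum_i neg_mult i)%N ->
  num_relations gamma a b = 0%N.
Proof.
move=> abd abn; apply/eqP; rewrite sum_nat_eq0; apply/forallP => phi /=.
rewrite sum_nat_eq0; apply/forallP => psi /=; rewrite eqb0.
apply: contra abn => /forallP mg.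
have E : (\sum_i (mult phi i + neg_mult i) = \sum_i (mult psi i + pos_mult i))%N.
  apply: eq_bigr => i _; have /eqP := mg i; rewrite {1}pos_neg_mult; lia.
rewrite !big_split /= !sum_mult in E.
move: abd; rewrite (eq_bigr _ (fun i _ => abs_gamma i)) big_split /= => abd.
have D : (\sum_i (pos_mult i + neg_mult i) <= \sum_i (mult phi i + mult psi i))%N.
  apply: leq_sum => i _; rewrite -abs_gamma -(eqP (mg i)); lia.
rewrite !big_split /= !sum_mult in D.
by rewrite xpair_eqE; lia.
Qed.

Lemma num_relations_gt0 :
  (0 < num_relations gamma (\sum_i pos_mult i) (\sum_i neg_mult i))%N.
Proof.
have [phi phiE] := mult_surj (erefl (\sum_i pos_mult i)%N).
have [psi psiE] := mult_surj (erefl (\sum_i neg_mult i)%N).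
rewrite /num_relations (bigD1 phi)//= (bigD1 psi)//=.
have -> : [forall i, (mult phi i)%:Z - (mult psi i)%:Z == gamma i].
  by apply/forallP => i; rewrite phiE psiE -pos_neg_mult.
by rewrite -!addnA.
Qed.

(** Up to the number of families of roots of unity, the factor that the averaged squared modulus of
    the truncated series leaves in front of [prod_i u_i^gamma_i]. *)
Definition relation_series (h : R) (N : nat) (rho : R) : R :=
  \sum_(a < N.+1) \sum_(b < N.+1)
    gbinom h a * gbinom h b * rho ^+ (a + b) * (num_relations gamma a b)%:R.

Lemma root_average_series (M : nat) (u : I -> R[i]) (h : R) (N : nat) (rho : R) :
  (0 < M)%N -> (forall i, N + N + `|gamma i| < M)%N -> (forall i, normc (u i) = 1) ->
  \sum_k root_wt gamma k
      * (normc (gbinom_series h N (rho%:C * \sum_i (root_pt (M := M) k i * u i))) ^+ 2)%:C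
  = (M%:R ^+ #|I| * relation_series h N rho)%:C * \prod_i u i ^ gamma i.
Proof.
move=> M0 gM u1.
have E (k : {ffun I -> 'I_M}) : let w := rho%:C * \sum_i (root_pt k i * u i) in
    root_wt gamma k * (normc (gbinom_series h N w) ^+ 2)%:C
  = \sum_(a < N.+1) \sum_(b < N.+1) (gbinom h a * gbinom h b)%:C
      * (root_wt gamma k * (w ^+ a * conjc w ^+ b)).
  move=> w; rewrite -mul_conj_normc.
  have -> : conjc (gbinom_series h N w)
      = \sum_(b < N.+1) (gbinom h b)%:C * conjc w ^+ b.
    rewrite /gbinom_series rmorph_sum; apply: eq_bigr => b _.
    by rewrite rmorphM rmorphXn; congr (_ * _); rewrite /= oppr0.
  rewrite /gbinom_series mulr_suml mulr_sumr; apply: eq_bigr => a _.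
  rewrite mulr_sumr mulr_sumr; apply: eq_bigr => b _.
  by rewrite [in RHS]rmorphM /=; ring.
rewrite (eq_bigr _ (fun k _ => E k)) exchange_big /=.
rewrite /relation_series mulr_sumr rmorph_sum mulr_suml; apply: eq_bigr => a _.
rewrite exchange_big mulr_sumr rmorph_sum mulr_suml; apply: eq_bigr => b _ /=.
rewrite -mulr_sumr root_average_monomial//; last first.
  move=> i; apply: leq_ltn_trans (gM i).
  by rewrite leq_add2r leq_add// -ltnS.
by rewrite mulrA -rmorphM /=; congr (_%:C * _); ring.
Qed.

(** Among the terms of degree at most [d] in [rho] only the one with [(a, b)] the sizes of the
    positive and negative parts of [gamma] survives; the others carry [rho^(d+1)] because
    [rho <= 1]. *)
Lemma relation_series_lead (h : R) :
  let d := (\sum_i `|gamma i|)%N in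
  let a := (\sum_i pos_mult i)%N in let b := (\sum_i neg_mult i)%N in
  let c := gbinom h a * gbinom h b * (num_relations gamma a b)%:R in
  exists2 C, 0 <= C & forall rho : R, 0 <= rho <= 1 ->
    `|relation_series h d rho - c * rho ^+ d| <= C * rho ^+ d.+1.
Proof.
move=> d a b c.
have dE : d = (a + b)%N.
  by rewrite /d (eq_bigr _ (fun i _ => abs_gamma i)) big_split.
have ad : (a < d.+1)%N by rewrite dE ltnS leq_addr.
have bd : (b < d.+1)%N by rewrite dE ltnS leq_addl.
pose t (x y : nat) := `|gbinom h x * gbinom h y * (num_relations gamma x y)%:R|.
exists (\sum_(x < d.+1) \sum_(y < d.+1) t x y).
  by apply: sumr_ge0 => x _; apply: sumr_ge0 => y _; exact: normr_ge0.
move=> rho /andP[r0 r1].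
(* The leading term is spread over the double sum, with a single nonzero entry, to compare term by
   term. *)
have -> : c * rho ^+ d = \sum_(x < d.+1) \sum_(y < d.+1)
    if (x, y) == (Ordinal ad, Ordinal bd) then c * rho ^+ d else 0.
  rewrite pair_big /= (bigD1 (Ordinal ad, Ordinal bd))//= eqxx big1 ?addr0//.
  by move=> [x y] /= /negPf ->.
rewrite /relation_series -sumrB mulr_suml; apply: (le_trans (ler_norm_sum _ _ _)).
apply: ler_sum => x _; rewrite -sumrB mulr_suml.
apply: (le_trans (ler_norm_sum _ _ _)); apply: ler_sum => y _.
have R0 : 0 <= t x y * rho ^+ d.+1 by rewrite mulr_ge0 ?exprn_ge0 ?normr_ge0.
case: eqP => [[-> ->] /=|xyn].
  by rewrite -dE mulrAC subrr normr0 mulr_ge0 ?exprn_ge0 ?normr_ge0.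
rewrite subr0; case: (leqP (x + y) d) => [xyd|dxy].
  rewrite num_relations_eq0 ?mulr0 ?normr0//.
  by apply/eqP => -[xa yb]; apply: xyn; congr (_, _); exact: val_inj.
rewrite mulrAC normrM -/(t x y) ler_wpM2l ?normr_ge0// ger0_norm ?exprn_ge0//.
by rewrite ler_wiXn2l.
Qed.

End obstruction.

(** * Separation of the two signs *)

Section separation.
Context {R : realType} {I : finType} (gamma : I -> int) (h : R).
Context (h0 : 0 <= h).

Let d := (\sum_i `|gamma i|)%N.
(** The series is truncated at degree [d] and [|gamma i| <= d], so all the exponents to be told
    apart differ by at most [3 d]. *)
Let M := (3 * d).+1.

Definition weighted_mean (rho : R) (u : I -> R[i]) : R :=
  \sum_k complex.Re (root_wt gamma k)
    * normc (1 + rho%:C * \sum_i (root_pt (M := M) k i * u i)) `^ (2 * h).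

Lemma normc_root_wt (k : {ffun I -> 'I_M}) : normc (root_wt gamma k) = 1 :> R.
Proof.
rewrite normc_prod big1// => i _.
by rewrite normcXz normc_circle_param exp1rz.
Qed.

Lemma normc_perturbation (J : finType) (rho : R) (om u : J -> R[i]) :
  0 <= rho -> (forall i, normc (om i) = 1) -> (forall i, normc (u i) = 1) ->
  normc (rho%:C * \sum_i (om i * u i)) <= rho * #|J|%:R.
Proof.
move=> r0 om1 u1; rewrite ComplexField.Normc.normcM.
have -> : normc rho%:C = rho by rewrite /= expr0n addr0 sqrtr_sqr ger0_norm.
rewrite ler_wpM2l//; apply: (le_trans (normc_sum_le _)).
under eq_bigr do rewrite ComplexField.Normc.normcM om1 u1 mulr1.
by rewrite sumr_const.
Qed.

(** Two errors add up: replacing [|1 + w|^(2h)] by the truncated series for each [k], where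
    [|w| <= rho #|I|], and keeping only the leading term of the averaged series. The number [s] is
    the value, 1 or -1, of the surviving monomial. *)
Lemma weighted_mean_expansion :
  let c := gbinom h (\sum_i pos_mult gamma i) * gbinom h (\sum_i neg_mult gamma i)
           * (num_relations gamma (\sum_i pos_mult gamma i)
                                  (\sum_i neg_mult gamma i))%:R in
  exists2 C, 0 <= C & forall (rho s : R) (u : I -> R[i]),
    0 <= rho <= 1 -> rho * #|I|%:R <= 2^-1 -> (forall i, normc (u i) = 1) ->
    `|s| = 1 -> \prod_i u i ^ gamma i = s%:C ->
    `|weighted_mean rho u - M%:R ^+ #|I| * (c * rho ^+ d * s)|
      <= M%:R ^+ #|I| * (C * rho ^+ d.+1).
Proof.
move=> c.
have [C1 C10 H1] := taylor_normc d h0.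
have [C2 C20 H2] := relation_series_lead gamma h.
exists (C2 + C1 * #|I|%:R ^+ d.+1).
  by rewrite addr_ge0// mulr_ge0// exprn_ge0.
move=> rho s u r01 rI u1 s1 us; have /andP[r0 r1] := r01.
have gM i : (d + d + `|gamma i| < M)%N.
  have : (`|gamma i| <= d)%N by rewrite /d (bigD1 i)//= leq_addr.
  by rewrite /M; lia.
have := root_average_series h rho (ltn0Sn _ : (0 < M)%N) gM u1.
rewrite us -rmorphM => /(congr1 (@complex.Re R)) /=.
pose w k := rho%:C * \sum_i (root_pt (M := M) k i * u i).
rewrite -/M => avg.
have {}avg : \sum_k complex.Re (root_wt gamma k)
      * normc (gbinom_series h d (w k)) ^+ 2
    = M%:R ^+ #|I| * relation_series gamma h d rho * s.
  rewrite -avg (raddf_sum (@complex.Re R)) /=; apply: eq_bigr => k _.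
  by case: (root_wt _ _) => x y /=; rewrite mulr0 subr0.
have Mx : (M%:R ^+ #|I| : R) = \sum_(k : {ffun I -> 'I_M}) 1.
  by rewrite sumr_const card_ffun card_ord natrX.
have M0 : 0 <= M%:R ^+ #|I| :> R by rewrite exprn_ge0.
rewrite (_ : weighted_mean _ _ - _ =
    (weighted_mean rho u - M%:R ^+ #|I| * relation_series gamma h d rho * s)
    + M%:R ^+ #|I| * ((relation_series gamma h d rho - c * rho ^+ d) * s));
  last by ring.
apply: (le_trans (ler_normD _ _)).
rewrite [leRHS](_ : _ = M%:R ^+ #|I| * (C1 * #|I|%:R ^+ d.+1 * rho ^+ d.+1)
  + M%:R ^+ #|I| * (C2 * rho ^+ d.+1)); last by ring.
apply: lerD; last first.
  rewrite normrM (ger0_norm M0) ler_wpM2l// normrM s1 mulr1.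
  exact: H2.
rewrite -avg /weighted_mean -sumrB.
apply: (le_trans (ler_norm_sum _ _ _)).
rewrite Mx mulr_suml; apply: ler_sum => k _.
rewrite -mulrBr normrM; apply: ler_pM => //.
  by rewrite (le_trans (ler_norm_Re_normc _))// normc_root_wt.
have wb : normc (w k) <= rho * #|I|%:R.
  by apply: normc_perturbation => // i; exact: normc_circle_param.
apply: (le_trans (H1 _ (le_trans wb rI))).
rewrite -mulrA ler_wpM2l// -exprMn mulrC; apply: lerXn2r => //.
  by rewrite nnegrE normc_ge0.
by rewrite nnegrE mulr_ge0.
Qed.

(** The leading terms for [u] and [v] are opposite, so the weighted means differ by twice the
    leading term up to twice the error. As [Delta] depends on neither [u] nor [v], it will serve all
    relations with the same coefficients. *)
Lemma sign_separation :
  gbinom h (\sum_i pos_mult gamma i) != 0 ->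
  gbinom h (\sum_i neg_mult gamma i) != 0 ->
  exists (K : finType) (kap : K -> R) (om : K -> I -> R[i]) (rho Delta : R),
  [/\ forall k i, normc (om k i) = 1, 0 <= rho <= 1, 0 < Delta &
    forall u v : I -> R[i],
      (forall i, normc (u i) = 1) -> (forall i, normc (v i) = 1) ->
      \prod_i u i ^ gamma i = 1 -> \prod_i v i ^ gamma i = -1 ->
      Delta <= \sum_k kap k *
        (normc (1 + rho%:C * \sum_i (om k i * u i)) `^ (2 * h)
         - normc (1 + rho%:C * \sum_i (om k i * v i)) `^ (2 * h))].
Proof.
move=> ga gb; have [C C0 HC] := weighted_mean_expansion.
set c := gbinom h (\sum_i pos_mult gamma i) * _ * _ in HC.
have c0 : 0 < `|c|.
  rewrite normr_gt0 (mulf_neq0 (mulf_neq0 ga gb))// pnatr_eq0 -lt0n.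
  exact: num_relations_gt0.
pose m : R := #|I|%:R.
have m0 : 0 <= m by [].
(* Chosen so that [q <= 1] and [C q < |c|]: the error stays below the leading term. *)
pose q := `|c| / (`|c| + C + 1).
have den : 0 < `|c| + C + 1 by lra.
have q0 : 0 < q by rewrite divr_gt0.
have q1 : q <= 1 by rewrite ler_pdivrMr//; lra.
have qC : C * q < `|c|.
  by rewrite /q mulrA ltr_pdivrMr//; nra.
(* This ensures both [rho <= q] and [rho m <= 1/2], the latter being the range of the Taylor
   estimate. *)
pose rho := q / (2 * (m + 1)).
have den2 : 0 < 2 * (m + 1) by lra.
have r0 : 0 < rho by rewrite divr_gt0.
have r1 : rho <= q by rewrite ler_pdivrMr//; nra.
have rm : rho * m <= 2^-1.
  by rewrite /rho mulrAC ler_pdivrMr//; nra.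
have r01 : 0 <= rho <= 1 by rewrite ltW//= (le_trans r1).
have Mp : 0 < M%:R ^+ #|I| :> R by rewrite exprn_gt0.
(* The factor [sg c] makes the difference of the means positive. *)
exists {ffun I -> 'I_M}, (fun k => Num.sg c * complex.Re (root_wt gamma k)),
  (fun k i => root_pt k i), rho,
  (2 * (M%:R ^+ #|I| * rho ^+ d * (`|c| - C * rho))).
split => //.
- by move=> k i; exact: normc_circle_param.
- rewrite !mulr_gt0 ?exprn_gt0//; nra.
move=> u v u1 v1 up vm.
have := HC rho 1 u r01 rm u1; rewrite normr1 up => /(_ erefl erefl) Hu.
have := HC rho (-1) v r01 rm v1; rewrite normrN1 vm => /(_ erefl).
have -> : (-1)%:C = -1 :> R[i] by apply/eqP; rewrite eq_complex /= oppr0 !eqxx.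
move=> /(_ erefl) Hv.
under eq_bigr do rewrite -mulrA mulrBr.
rewrite -mulr_sumr sumrB -/(weighted_mean rho u) -/(weighted_mean rho v).
move: Hu Hv; rewrite exprSr.
move: (weighted_mean _ _) (weighted_mean _ _) => x y.
set A := M%:R ^+ #|I|; set B := rho ^+ d.
rewrite !ler_norml => /andP[u2 u3] /andP[v2 v3].
case: (sgrP c) => cs; rewrite ?mul1r ?mulN1r; nra.
Qed.

End separation.

(** * The L^p norm of a trigonometric polynomial *)

Section mean_on_circle.
Context {R : realType}.
Implicit Types (f g : R -> R).

(** A class stable under linear combinations and integrable for any probability, which disposes of
    integrability conditions once and for all. *)
Definition bmeas f := measurable_fun setT f /\ exists B, forall t, `|f t| <= B.

Definition mean f : R := \int[uniform_prob (@ltr01 R)]_t f t.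

Lemma bmeas_integrable f : bmeas f ->
  (uniform_prob (@ltr01 R)).-integrable setT (EFin \o f).
Proof.
move=> [mf [B fB]]; apply: measurable_bounded_integrable => //.
  by apply: le_lt_trans (ltry 1); exact: probability_le1.
by exists B; split=> [|x Bx t _]; [exact: num_real|exact: le_trans (fB t) (ltW Bx)].
Qed.

Lemma bmeas_cst c : bmeas (fun=> c).
Proof. by split; [exact: measurable_cst|exists `|c|]. Qed.

Lemma bmeasZ c f : bmeas f -> bmeas (fun t => c * f t).
Proof.
move=> [mf [B fB]]; split; first exact: measurable_funM.
by exists (`|c| * B) => t; rewrite normrM ler_wpM2l.
Qed.

Lemma bmeasD f g : bmeas f -> bmeas g -> bmeas (fun t => f t + g t).
Proof.
move=> [mf [B fB]] [mg [C gC]]; split; first exact: measurable_funD.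
by exists (B + C) => t; rewrite (le_trans (ler_normD _ _))// lerD.
Qed.

Lemma bmeas_sum (I : Type) (s : seq I) (f : I -> R -> R) :
  (forall i, bmeas (f i)) -> bmeas (fun t => \sum_(i <- s) f i t).
Proof.
move=> bf; elim: s => [|i s IH].
  rewrite (_ : (fun _ => _) = fun=> 0); first exact: bmeas_cst.
  by apply/funext => t; rewrite big_nil.
rewrite (_ : (fun _ => _) = fun t => f i t + \sum_(j <- s) f j t).
  exact: bmeasD.
by apply/funext => t; rewrite big_cons.
Qed.

Lemma meanZ c f : bmeas f -> mean (fun t => c * f t) = c * mean f.
Proof. by move=> bf; rewrite /mean RintegralZl//; exact: bmeas_integrable. Qed.

Lemma meanD f g : bmeas f -> bmeas g -> mean (fun t => f t + g t) = mean f + mean g.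
Proof. by move=> bf bg; rewrite /mean RintegralD//; exact: bmeas_integrable. Qed.

Lemma mean_cst c : mean (fun=> c) = c.
Proof.
have U1 : uniform_prob (@ltr01 R) setT = 1%E by exact: probability_setT.
rewrite /mean Rintegral_cst//.
by rewrite /= U1 mulr1.
Qed.

Lemma mean_sum (I : Type) (s : seq I) (f : I -> R -> R) :
  (forall i, bmeas (f i)) ->
  mean (fun t => \sum_(i <- s) f i t) = \sum_(i <- s) mean (f i).
Proof.
move=> bf; elim: s => [|i s IH].
  rewrite big_nil -[RHS]mean_cst; congr mean.
  by apply/funext => t; rewrite big_nil.
rewrite big_cons -IH -meanD//; last exact: bmeas_sum.
by congr mean; apply/funext => t; rewrite big_cons.
Qed.

Lemma le_mean f g : bmeas f -> bmeas g -> (forall t, f t <= g t) ->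
  mean f <= mean g.
Proof. by move=> bf bg fg; apply: le_Rintegral => //; exact: bmeas_integrable. Qed.

Lemma mean_EFin f : bmeas f ->
  (\int[uniform_prob (@ltr01 R)]_t (f t)%:E)%E = (mean f)%:E.
Proof.
move=> /bmeas_integrable bf; rewrite /mean /Rintegral fineK//.
exact: integrable_fin_num.
Qed.

Lemma trig_poly_circle (G : {fset int}) (a : int -> R[i]) (t : R) :
  trig_poly G a (circle_param t) =
  \sum_(q <- G) a q * circle_param (t * q%:~R).
Proof. by apply: eq_bigr => q _; rewrite /char_circle circle_paramXz. Qed.

Lemma bmeas_Re_circle (c : R[i]) (x : R) :
  bmeas (fun t => complex.Re (c * circle_param (t * x))).
Proof.
case: c => u v; split.
  rewrite /circle_param /=.
  have ml : measurable_fun setT (fun t : R => 2 * pi * (t * x)).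
    by do 2! apply: measurable_funM => //.
  apply: measurable_funB; apply: measurable_funM => //.
    exact: measurableT_comp (continuous_measurable_fun (@continuous_cos R)) ml.
  exact: measurableT_comp (continuous_measurable_fun (@continuous_sin R)) ml.
exists (normc (u +i* v)) => t; apply: (le_trans (ler_norm_Re_normc _)).
by rewrite ComplexField.Normc.normcM normc_circle_param mulr1.
Qed.

Lemma bmeas_normc_trig_poly (p : R) (G : {fset int}) (a : int -> R[i]) :
  0 <= p -> bmeas (fun t => normc (trig_poly G a (circle_param t)) `^ p).
Proof.
move=> p0.
have ReM (b : int -> R[i]) : measurable_fun setT
    (fun t : R => complex.Re (\sum_(q <- G) b q * circle_param (t * q%:~R))).
  rewrite (_ : (fun _ => _) = fun t : R =>
     \sum_(q <- G) complex.Re (b q * circle_param (t * q%:~R))).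
    by have [] := @bmeas_sum _ G _ (fun q : int => bmeas_Re_circle (b q) q%:~R).
  by apply/funext => t; rewrite (raddf_sum (@complex.Re R)).
(* The imaginary part is the real part of another trigonometric polynomial, so measurability of real
   parts suffices. *)
have ImE (z : R[i]) : complex.Im z = complex.Re (- 'i%C * z).
  by case: z => x y /=; ring.
split.
  apply: (measurableT_comp (measurable_powR p)).
  rewrite (_ : (fun _ => _) = fun t : R => Num.sqrt
    (complex.Re (\sum_(q <- G) a q * circle_param (t * q%:~R)) ^+ 2
    + complex.Re (\sum_(q <- G) (- 'i%C * a q) * circle_param (t * q%:~R)) ^+ 2)).
    apply: (measurableT_comp (continuous_measurable_fun (@sqrt_continuous R))).
    by apply: measurable_funD; apply: measurable_funX; exact: ReM.
  apply/funext => t; rewrite trig_poly_circle.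
  rewrite (eq_bigr _ (fun q _ => esym (mulrA (- 'i%C) (a q) _))) -mulr_sumr -ImE.
  by case: (\sum_(q <- G) _).
exists ((\sum_(q <- G) normc (a q)) `^ p) => t.
rewrite ger0_norm ?powR_ge0//; apply: ge0_ler_powR => //.
- by rewrite nnegrE normc_ge0.
- by rewrite nnegrE sumr_ge0// => q _; exact: normc_ge0.
rewrite trig_poly_circle; elim/big_ind2: _ => //.
- by rewrite ComplexField.Normc.normc0.
- by move=> z x z' x' zx zx'; rewrite (le_trans (le_normcD _ _))// lerD.
by move=> q _; rewrite ComplexField.Normc.normcM normc_circle_param mulr1.
Qed.

Lemma Lp_circle_trig_poly (p : R) (G : {fset int}) (a : int -> R[i]) : 0 <= p ->
  Lp_circle p (trig_poly G a) =
  (mean (fun t => normc (trig_poly G a (circle_param t)) `^ p) `^ p^-1)%:E.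
Proof.
move=> p0; rewrite /Lp_circle unlock -poweR_EFin -mean_EFin; last first.
  exact: bmeas_normc_trig_poly.
congr (_ `^ _)%E; apply: eq_integral => t _.
by rewrite abse_EFin ger0_norm ?normc_ge0// poweR_EFin.
Qed.

Lemma Lp_circle_le (p c : R) (G H : {fset int}) (a b : int -> R[i]) :
  0 < p -> 0 <= c ->
  (Lp_circle p (trig_poly G a) <= c%:E * Lp_circle p (trig_poly H b))%E ->
  mean (fun t => normc (trig_poly G a (circle_param t)) `^ p) <=
  c `^ p * mean (fun t => normc (trig_poly H b (circle_param t)) `^ p).
Proof.
move=> p0 c0; rewrite !Lp_circle_trig_poly ?(ltW p0)// -EFinM lee_fin => le1.
have mean_ge0 (K : {fset int}) (d : int -> R[i]) :
    0 <= mean (fun t => normc (trig_poly K d (circle_param t)) `^ p).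
  rewrite -[leLHS]mean_cst; apply: le_mean; first exact: bmeas_cst.
    by apply: bmeas_normc_trig_poly; exact: ltW.
  by move=> t; exact: powR_ge0.
have pK x : 0 <= x -> (x `^ p^-1) `^ p = x.
  by move=> x0; rewrite -powRrM mulVf ?gt_eqF// powRr1.
rewrite -(pK (mean _)) ?mean_ge0//.
rewrite -(pK (mean (fun t => normc (trig_poly H b _) `^ p))) ?mean_ge0//.
rewrite -powRM ?powR_ge0//; apply: ge0_ler_powR; rewrite ?nnegrE ?mulr_ge0 ?powR_ge0//.
exact: ltW.
Qed.

End mean_on_circle.

(** * Metric unconditionality implies almost independence *)

Section metric_unconditionality.
Context {R : realType}.

Definition trig_mean (p : R) (G : {fset int}) (a : int -> R[i]) : R :=
  mean (fun t => normc (trig_poly G a (circle_param t)) `^ p).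

Lemma umbs_trig_mean (p : R) (S : set R[i]) (E : set int) (tau : R) :
  0 < p -> umbs (Lp_circle p) S E -> 0 < tau ->
  exists F : {fset int}, forall (G : {fset int}) (a eps : int -> R[i]),
    [set` G] `<=` E `\` [set` F] -> (forall q, q \in G -> S (eps q)) ->
    trig_mean p G (fun q => eps q * a q) <= (1 + tau) * trig_mean p G a.
Proof.
move=> p0 uE tau0.
have t1 : 1 < (1 + tau) `^ p^-1.
  have one : 1 `^ p^-1 = 1 :> R by rewrite powR1.
  by rewrite -[ltLHS]one gt0_ltr_powR ?invr_gt0 ?nnegrE//; lra.
(* With this tolerance the [p]-th power of the constant is [1 + tau]. The admissible [C] found below
   it may be negative if no frequency is left, so it is replaced by the nonnegative
   [(1 + tau)^(1/p)] before taking powers. *)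
have := uE ((1 + tau) `^ p^-1 - 1); rewrite subr_gt0 => /(_ t1)[F].
rewrite addrC subrK => /ereal_inf_lt[_ [C CE <-]]; rewrite lte_fin => Clt.
exists F => G a eps GE Se.
have -> : 1 + tau = ((1 + tau) `^ p^-1) `^ p.
  by rewrite -powRrM mulVf ?gt_eqF// powRr1//; lra.
apply: Lp_circle_le => //; first exact: powR_ge0.
apply: (le_trans (CE G a eps GE Se)).
rewrite Lp_circle_trig_poly ?(ltW p0)// -!EFinM lee_fin.
by rewrite ler_wpM2r ?powR_ge0// ltW.
Qed.

Lemma trig_poly_codom (m : nat) (r : 'I_m -> int) (A : 'I_m -> R[i]) :
  injective r -> exists a : int -> R[i], (forall i, a (r i) = A i).
Proof.
move=> rinj; exists (fun q => \sum_i (if r i == q then A i else 0)) => i.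
by rewrite (bigD1 i)//= eqxx big1 ?addr0// => j ji; rewrite (inj_eq rinj) (negPf ji).
Qed.

Lemma trig_poly_seq_fset (m : nat) (r : 'I_m -> int) (a : int -> R[i]) (z : R[i]) :
  injective r ->
  trig_poly (seq_fset tt (codom r)) a z = \sum_i a (r i) * z ^ r i.
Proof.
move=> rinj; rewrite /trig_poly (perm_big _ (seq_fset_perm _ _)).
rewrite undup_id; last by rewrite map_inj_uniq ?enum_uniq.
by rewrite /codom /image_mem big_map big_enum.
Qed.

(* Factoring out the character [z ^ r i0] exhibits a polynomial with spectrum
   [r] as a perturbation of the constant 1. *)
Lemma normc_trig_poly_lift (m : nat) (i0 : 'I_m.+1) (r : 'I_m.+1 -> int)
    (a : int -> R[i]) (z : R[i]) (rho : R) (om : 'I_m -> R[i]) :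
  injective r -> normc z = 1 -> a (r i0) = 1 ->
  (forall i, a (r (lift i0 i)) = rho%:C * om i) ->
  normc (trig_poly (seq_fset tt (codom r)) a z) =
  normc (1 + rho%:C * \sum_i (om i * z ^ (r (lift i0 i) - r i0))).
Proof.
move=> rinj z1 a0 ai; have z0 := unimodular_neq0 z1.
rewrite trig_poly_seq_fset// (bigD1_ord i0)//= a0 mul1r.
rewrite -[RHS]mul1r -(_ : normc (z ^ r i0) = 1); last first.
  by rewrite normcXz z1 exp1rz.
rewrite -ComplexField.Normc.normcM mulrDr mulr1; congr (normc (_ + _)).
rewrite mulrCA mulr_sumr mulr_sumr; apply: eq_bigr => i _.
have -> : z ^ r (lift i0 i) = z ^ r i0 * z ^ (r (lift i0 i) - r i0).
  by rewrite -expfzDr// addrC subrK.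
by rewrite ai; ring.
Qed.

Lemma mutual_le_close (x y tau B : R) : 0 <= tau -> x <= B -> y <= B ->
  x <= (1 + tau) * y -> y <= (1 + tau) * x -> `|x - y| <= tau * B.
Proof. by move=> *; rewrite ler_norml; apply/andP; split; nra. Qed.

(** The tolerance [tau], hence [F], is computed from [p] and [zeta] before any [r] is given. A
    relation among frequencies outside [F] would let one change of sign alter some mean by more than
    [tau] allows. *)
Lemma umbs_no_relation (p : R) (E : set int) (n m : nat) (zeta : 'I_m -> int)
    (j : 'I_m) :
  0 < p -> (forall l, (l < n)%N -> p <> (2 * l)%:R) ->
  umbs (Lp_circle p) (@real_signs R) E ->
  zero_sum_le n zeta -> odd `|zeta j| ->
  exists F : {fset int}, forall r : 'I_m -> int, injective r ->
    (forall i, (E `\` [set` F]) (r i)) -> \sum_i zeta i * r i != 0.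
Proof.
move=> p0 pn uE [[z0 zs] zn] oj.
case: m zeta j z0 zs zn oj => [|m] zeta j z0 zs zn oj; first by case: j {oj}.
(* If [j] were the only index, the zero sum would give [zeta j = 0]. *)
have [i0 i0j] : exists i0, i0 != j.
  apply: contrapT => /forallNP H; move/eqP: zs; apply/negP.
  rewrite (bigD1 j)//= big1 ?addr0 ?z0// => i ij.
  by case: (H i).
have [j' jE|] := unliftP i0 j; last by move=> ji; rewrite ji eqxx in i0j.
pose gamma i := zeta (lift i0 i).
(* The positive and negative parts of [zeta] have equal size, at most [n]. Removing [i0] does not
   increase them, so the binomial coefficients of [p / 2] involved could vanish only if [p / 2] were
   an integer below [n]. *)
have bal : (\sum_i pos_mult zeta i = \sum_i neg_mult zeta i)%N.
  apply/eqP; rewrite -eqz_nat -subr_eq0 -zs.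
  rewrite (eq_bigr _ (fun i _ => pos_neg_mult zeta i)) sumrB.
  by rewrite -!(big_morph Posz PoszD (erefl _)).
have tot : (\sum_i pos_mult zeta i + \sum_i neg_mult zeta i <= 2 * n)%N.
  apply: leq_trans zn; rewrite -big_split /= leq_eqVlt; apply/orP; left.
  by apply/eqP; apply: eq_bigr => i _; rewrite abs_gamma.
have gp : (\sum_i pos_mult gamma i <= n)%N.
  apply: (@leq_trans (\sum_i pos_mult zeta i)); last by lia.
  by rewrite (bigD1_ord i0)//= leq_addl.
have gn : (\sum_i neg_mult gamma i <= n)%N.
  apply: (@leq_trans (\sum_i neg_mult zeta i)); last by lia.
  by rewrite (bigD1_ord i0)//= leq_addl.
have h0 : 0 <= p / 2 by rewrite divr_ge0// ltW.
have hn l : (l < n)%N -> p / 2 != l%:R.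
  move=> /pn pl; apply: contra_notN pl => /eqP pl.
  by rewrite natrM -pl mulrC divfK.
have [||K [kap [om [rho [Delta [om1 /andP[r0 r1] D0 sep]]]]]] :=
    @sign_separation R _ gamma (p / 2) h0.
- by apply: gbinom_neq0 => l lp; apply: hn; exact: leq_trans gp.
- by apply: gbinom_neq0 => l lp; apply: hn; exact: leq_trans gn.
have p2 : 2 * (p / 2) = p by rewrite mulrC divfK.
rewrite p2 in sep.
(* Bounds the [p]-th power of the modulus of [1 + rho sum_i w_i u_i] for unimodular [w_i] and [u_i],
   since [rho <= 1]. *)
pose B : R := (1 + m%:R) `^ p.
have B0 : 0 <= B by exact: powR_ge0.
pose S : R := \sum_k `|kap k|.
have S0 : 0 <= S by apply: sumr_ge0.
(* Makes [S tau B < Delta]; the added 1 avoids a zero denominator. *)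
pose tau := Delta / (B * S + 1).
have BS0 : 0 <= B * S by rewrite mulr_ge0.
have tau0 : 0 < tau by rewrite divr_gt0//; lra.
have [F HF] := umbs_trig_mean p0 uE tau0.
exists F => r rinj rE; apply/eqP => rel.
pose G := seq_fset tt (codom r).
have GE : [set` G] `<=` E `\` [set` F].
  by move=> q /=; rewrite seq_fsetE => /codomP[i ->]; exact: rE.
have sgn_ex : exists s : int -> R[i], forall i, s (r i) = if i == j then -1 else 1.
  exact: trig_poly_codom.
have [s sE] := sgn_ex.
have ss q : q \in G -> s q = 1 \/ s q = -1.
  by rewrite seq_fsetE => /codomP[i ->]; rewrite sE; case: eqP; [right|left].
have aex k : exists b : int -> R[i],
    b (r i0) = 1 /\ forall i, b (r (lift i0 i)) = rho%:C * om k i.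
  have [a aE] := trig_poly_codom
    (fun i => if unlift i0 i is Some i' then rho%:C * om k i' else 1) rinj.
  by exists a; split=> [|i]; rewrite aE ?unlift_none ?liftK.
have [a aE] := boolp.choice aex.
have mean_le (b : int -> R[i]) (w : 'I_m -> R[i]) :
    (forall i, normc (w i) = 1) -> b (r i0) = 1 ->
    (forall i, b (r (lift i0 i)) = rho%:C * w i) -> trig_mean p G b <= B.
  move=> w1 b0 bi; rewrite -[leRHS]mean_cst; apply: le_mean.
  - by apply: bmeas_normc_trig_poly; exact: ltW.
  - exact: bmeas_cst.
  move=> t; apply: ge0_ler_powR; rewrite ?nnegrE ?normc_ge0 ?addr_ge0//.
    exact: ltW.
  rewrite (normc_trig_poly_lift rinj (normc_circle_param t) b0 bi).
  apply: (le_trans (le_normcD _ _)).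
  rewrite ComplexField.Normc.normc1 lerD2l.
  apply: (le_trans (normc_perturbation r0 w1 _)).
    by move=> i; rewrite normcXz normc_circle_param exp1rz.
  by rewrite card_ord ler_piMl.
pose u t i : R[i] := circle_param t ^ (r (lift i0 i) - r i0).
pose sg i : R[i] := if i == j' then -1 else 1.
have sg1 i : normc (sg i) = 1.
  rewrite /sg; case: ifP => _; last exact: ComplexField.Normc.normc1.
  by rewrite normcN ComplexField.Normc.normc1.
have u1 t i : normc (u t i) = 1 by rewrite normcXz normc_circle_param exp1rz.
have sr0 : s (r i0) = 1 by rewrite sE (negPf i0j).
have sri i : s (r (lift i0 i)) = sg i.
  by rewrite sE jE (inj_eq lift_inj).
pose sa k q := s q * a k q.
have sa0 k : sa k (r i0) = 1 by rewrite /sa sr0 (aE k).1 mulr1.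
have sai k i : sa k (r (lift i0 i)) = rho%:C * (om k i * sg i).
  by rewrite /sa sri (aE k).2 mulrC mulrA.
have omsg k i : normc (om k i * sg i) = 1.
  by rewrite ComplexField.Normc.normcM om1 sg1 mulr1.
(* The exponent is [sum_i zeta_i (r_i - r_i0)], which vanishes by the relation and the zero sum; the
   index [i0] contributes nothing to it. *)
have upow t : \prod_i u t i ^ gamma i = 1.
  rewrite (eq_bigr (fun i => circle_param (t * ((r (lift i0 i) - r i0) * gamma i)%:~R))).
    rewrite -(big_morph (fun x : R => circle_param x) (@circle_paramD R) circle_param0).
    rewrite -mulr_sumr -rmorph_sum /= (_ : \sum_i _ = 0) ?mulr0 ?circle_param0//.
    move: rel zs; rewrite !(bigD1_ord i0)//= => rel zs.
    under eq_bigr do rewrite mulrBl.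
    rewrite sumrB -mulr_sumr -/gamma.
    have -> : \sum_i gamma i = - zeta i0 by apply/eqP; rewrite -addr_eq0 addrC zs.
    by rewrite mulrN opprK -[RHS]rel addrC mulrC; congr (_ + _);
       apply: eq_bigr => i _; rewrite mulrC.
  by move=> i _; rewrite /u exprz_exp circle_paramXz.
(* Only the factor at [j'] changes, by [(-1)^(zeta j)], and [zeta j] is odd. *)
have vpow t : \prod_i (sg i * u t i) ^ gamma i = -1.
  under eq_bigr do rewrite expfzMl.
  rewrite big_split /= upow mulr1 (bigD1 j')//= big1 ?mulr1.
    rewrite /sg eqxx /gamma -jE; move: oj.
    case: (zeta j) => l ol; first by rewrite -exprnP -signr_odd ol expr1.
    rewrite -[LHS]/(((-1) ^+ l.+1)^-1) -signr_odd.
    by move: ol => /= ->; rewrite invrN1.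
  by move=> i ij; rewrite /sg (negPf ij) exp1rz.
have fE k t : normc (trig_poly G (a k) (circle_param t))
    = normc (1 + rho%:C * \sum_i (om k i * u t i)).
  by apply: normc_trig_poly_lift => //; [exact: normc_circle_param|exact: (aE k).1
    |exact: (aE k).2].
have gE k t : normc (trig_poly G (sa k) (circle_param t))
    = normc (1 + rho%:C * \sum_i (om k i * (sg i * u t i))).
  rewrite (normc_trig_poly_lift rinj (normc_circle_param t) (sa0 k) (sai k)).
  by congr (normc (1 + _ * _)); apply: eq_bigr => i _; rewrite mulrA.
have close k : `|trig_mean p G (a k) - trig_mean p G (sa k)| <= tau * B.
  have le1 := HF G (a k) s GE ss.
  have := HF G (sa k) s GE ss; rewrite -/(sa k) in le1.
  (* Applying the signs twice restores the coefficients, so the unconditionality inequality holds in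
     both directions. *)
  have -> : trig_mean p G (fun q => s q * sa k q) = trig_mean p G (a k).
    rewrite /trig_mean; congr mean; apply/funext => t; congr (normc _ `^ p).
    rewrite /trig_poly !big_seq; apply: eq_bigr => q /ss sq.
    by congr (_ * _); rewrite /sa mulrA; case: sq => ->; rewrite ?mulrNN !mul1r.
  have b1 : trig_mean p G (a k) <= B := mean_le _ _ (om1 k) (aE k).1 (aE k).2.
  have b2 : trig_mean p G (sa k) <= B := mean_le _ _ (omsg k) (sa0 k) (sai k).
  by move=> le2; apply: mutual_le_close => //; exact: ltW.
have : Delta <= \sum_k kap k * (trig_mean p G (a k) - trig_mean p G (sa k)).
  have bm k : bmeas (fun t => normc (trig_poly G (a k) (circle_param t)) `^ p).
    by apply: bmeas_normc_trig_poly; exact: ltW.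
  have bs k : bmeas (fun t => -1 * normc (trig_poly G (sa k) (circle_param t)) `^ p).
    by apply: bmeasZ; apply: bmeas_normc_trig_poly; exact: ltW.
  have bk k := bmeasZ (kap k) (bmeasD (bm k) (bs k)).
  rewrite (eq_bigr (fun k => mean (fun t => kap k *
      (normc (trig_poly G (a k) (circle_param t)) `^ p
       + -1 * normc (trig_poly G (sa k) (circle_param t)) `^ p)))); last first.
    move=> k _; rewrite meanZ; last exact: bmeasD.
    rewrite meanD// meanZ ?mulN1r//.
    by apply: bmeas_normc_trig_poly; exact: ltW.
  rewrite -mean_sum// -[leLHS]mean_cst; apply: le_mean => [||t].
  - exact: bmeas_cst.
  - exact: bmeas_sum.
  apply: (le_trans (sep (u t) (fun i => sg i * u t i) (u1 t) _ (upow t) (vpow t))).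
    by move=> i; rewrite ComplexField.Normc.normcM sg1 u1 mulr1.
  by apply: ler_sum => k _; rewrite fE gE mulN1r.
apply/negP; rewrite -ltNge.
apply: (@le_lt_trans _ _ (S * (tau * B))).
  rewrite mulr_suml; apply: ler_sum => k _.
  apply: (le_trans (ler_norm _)); rewrite normrM.
  by rewrite ler_wpM2l.
have -> : S * (tau * B) = Delta * (B * S) / (B * S + 1) by rewrite /tau; ring.
rewrite ltr_pdivrMr; last by lra.
by rewrite ltr_pM2l//; lra.
Qed.

End metric_unconditionality.

(** Descent: while all coefficients are even, halving them preserves every constraint and decreases
    the sum of their absolute values, which stays positive. *)
Lemma odd_relation (n m : nat) (zeta r : 'I_m -> int) :
  (0 < m)%N -> zero_sum_le n zeta -> \sum_i zeta i * r i = 0 ->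
  exists zeta' : 'I_m -> int, [/\ zero_sum_le n zeta',
    \sum_i zeta' i * r i = 0 & exists j, odd `|zeta' j|].
Proof.
move=> m0; have [N] := ubnP (\sum_i `|zeta i|)%N.
elim: N zeta => // N IH zeta; rewrite ltnS => zN [[z0 zs] zn] rel.
have [[j oj]|even] := pselect (exists j, odd `|zeta j|).
  by exists zeta; split=> //; exists j.
pose zeta' i := (zeta i %/ 2)%Z.
have zE i : zeta i = 2 * zeta' i.
  have : ~~ odd `|zeta i| by apply/negP => oi; apply: even; exists i.
  rewrite /zeta'; lia.
have absE i : `|zeta i|%N = (2 * `|zeta' i|)%N by rewrite zE abszM.
have z'0 i : zeta' i != 0 by apply: contraNN (z0 i) => /eqP z; rewrite zE z.
have sumE : (\sum_i `|zeta i| = 2 * \sum_i `|zeta' i|)%N.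
  by rewrite big_distrr; apply: eq_bigr => i _; exact: absE.
have pos : (0 < \sum_i `|zeta' i|)%N.
  by rewrite (bigD1 (Ordinal m0))//= addn_gt0 absz_gt0 z'0.
apply: (IH zeta'); first by lia.
- split; last by lia.
  split=> //; apply: (@mulfI _ (2 : int)) => //.
  by rewrite mulr0 -[RHS]zs mulr_sumr; apply: eq_bigr => i _; rewrite -zE.
- apply: (@mulfI _ (2 : int)) => //.
  rewrite mulr0 -[RHS]rel mulr_sumr; apply: eq_bigr => i _.
  by rewrite [in RHS]zE mulrA.
Qed.

(** The finite sets given by unconditionality may leave [E], whereas almost independence asks for a
    subset of [E]: their union is cut down to [E]. *)
Lemma finite_union_fset (T : finType) (F : T -> {fset int}) (E : set int) :
  exists2 G : {fset int}, [set` G] `<=` E &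
    forall t q, (E `\` [set` G]) q -> (E `\` [set` F t]) q.
Proof.
pose s := flatten [seq enum_fset (F t) | t <- enum T].
pose G := seq_fset tt [seq q <- s | `[<E q>]].
have GE q : (q \in G) = `[<E q>] && (q \in s) by rewrite seq_fsetE mem_filter.
exists G => [q|t q [Eq qG]].
  by move=> qG; have := GE q; rewrite (qG : q \in G) => /esym/andP[/asboolP].
split=> // qF; apply: qG; suff: q \in G by [].
rewrite GE asboolT//=.
apply/flattenP.
by exists (enum_fset (F t)) => //; apply/mapP; exists t; rewrite ?mem_enum.
Qed.

Lemma umbs_almost_indep (R : realType) (p : R) (E : set int) (n : nat) :
  0 < p -> (forall l, (l < n)%N -> p <> (2 * l)%:R) ->
  umbs (Lp_circle p) (@real_signs R) E -> almost_indep n E.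
Proof.
move=> p0 pn uE.
(* A finite type coding all relevant [zeta]: nonzero coefficients of total size at most [2 n] number
   at most [2 n], and each becomes a natural number at most [4 n] after a shift by [2 n]. *)
pose T := {m : 'I_(2 * n).+1 & {ffun 'I_m -> 'I_(4 * n).+1}}.
pose dec (x : T) (i : 'I_(tag x)) : int := (tagged x i)%:Z - (2 * n)%:Z.
have Fex (x : T) : exists F : {fset int},
    zero_sum_le n (dec x) -> (exists j, odd `|dec x j|) ->
    forall r : 'I_(tag x) -> int, injective r ->
    (forall i, (E `\` [set` F]) (r i)) -> \sum_i dec x i * r i != 0.
  have [[zx [j oj]]|no] := pselect (zero_sum_le n (dec x) /\ exists j, odd `|dec x j|).
    by have [F HF] := umbs_no_relation p0 pn uE zx oj; exists F.
  (* Codes of no odd [zeta] receive a default set. *)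
  by exists fset0 => zx ox; case: no.
have [F HF] := boolp.choice Fex.
have [G GE GF] := finite_union_fset F E.
exists G => // m zeta r m0 zz rinj rE; apply/eqP => rel.
have [zeta' [[[z0 zs] zn] rel' oz]] := odd_relation m0 zz rel.
have zb i : (`|zeta' i| <= 2 * n)%N.
  by apply: leq_trans zn; rewrite (bigD1 i)//= leq_addr.
have mn : (m < (2 * n).+1)%N.
  rewrite ltnS; apply: leq_trans zn.
  rewrite -[leqLHS](card_ord m) -sum1_card; apply: leq_sum => i _.
  by rewrite absz_gt0.
pose x : T := existT _ (Ordinal mn)
  [ffun i : 'I_m => inord (absz (zeta' i + (2 * n)%:Z)%R)].
have xE : dec x = zeta'.
  apply/funext => i; rewrite /dec /= ffunE inordK; last by have := zb i; lia.
  by have := zb i; lia.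
have := HF x; rewrite xE => /(_ (conj (conj z0 zs) zn) oz r rinj) H.
by have := H (fun i => GF x _ (rE i)); rewrite rel' eqxx.
Qed.

(** * Even exponents *)

Section orthogonality.
Context {R : realType}.

Lemma is_derive_trig (b x y w t : R) : w != 0 ->
  is_derive t (1 : R) (fun s => b * s + (x / w * sin (w * s) + y / w * cos (w * s)))
    (b + (x * cos (w * t) - y * sin (w * t))).
Proof.
move=> w0.
have dl (v : R) : is_derive t (1 : R) (fun s => v * s) v.
  apply: (is_derive_eq (is_deriveZ v (is_derive_id t (1 : R)))).
  by rewrite /GRing.scale /= mulr1.
have ds := is_derive1_comp (is_derive_sin (w * t)) (dl w).
have dc := is_derive1_comp (is_derive_cos (w * t)) (dl w).
apply: (is_derive_eq (is_deriveD (dl b)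
  (is_deriveD (is_deriveZ (x / w) ds) (is_deriveZ (y / w) dc)))).
by rewrite /GRing.scale /=; field.
Qed.

Lemma mean_Re_circle (c : R[i]) (n : int) :
  mean (fun t => complex.Re (c * circle_param (t * n%:~R))) =
  if n == 0 then complex.Re c else 0.
Proof.
case: c => x y; set c := x +i* y.
have [->|n0] := eqVneq n 0.
  rewrite -[RHS]mean_cst; congr mean; apply/funext => t.
  by rewrite mulr0 circle_param0 mulr1.
have bg := bmeas_Re_circle c n%:~R.
set g := (X in mean X) in bg *.
pose b := normc c.
have gb t : `|g t| <= b.
  apply: (le_trans (ler_norm_Re_normc _)).
  by rewrite ComplexField.Normc.normcM normc_circle_param mulr1.
(* Adding the constant [b] makes the integrand nonnegative, as the formula for the integral against
   the uniform law requires. *)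
apply: (@addrI _ b); rewrite addr0 -{1}(mean_cst b).
rewrite -meanD//; last exact: bmeas_cst.
have bbg : bmeas (fun t => b + g t) by apply: bmeasD => //; exact: bmeas_cst.
apply: EFin_inj; rewrite -mean_EFin//.
rewrite integral_uniform; last 2 first.
- by apply/measurable_EFinP; exact: bbg.1.
- by move=> t; rewrite lee_fin; have := gb t; rewrite ler_norml => /andP[]; lra.
rewrite subr0 invr1 mul1e.
pose w : R := 2 * pi * n%:~R.
have w0 : w != 0 by rewrite !mulf_neq0 ?intr_eq0// gt_eqF ?pi_gt0.
have gE t : g t = x * cos (w * t) - y * sin (w * t).
  by rewrite /g /circle_param /= /w; congr (_ * cos _ - _ * sin _); ring.
pose F t := b * t + (x / w * sin (w * t) + y / w * cos (w * t)).
have dF (t : R) : is_derive t (1 : R) F (b + g t).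
  by rewrite gE; exact: is_derive_trig.
have cF : continuous F.
  by move=> t; apply: differentiable_continuous; apply/derivable1_diffP; exact: ex_derive.
(* Periodicity: the trigonometric part of the primitive takes the same value at 0 and 1. *)
have [cosw sinw] : cos w = 1 /\ sin w = 0.
  by have [] := @circle_param_int R n.
have cl (v : R) : continuous (fun t : R => v * t).
  by move=> t; apply: cvgM; [exact: cvg_cst|exact: cvg_id].
have cg : continuous (fun t => b + g t).
  under eq_fun do rewrite gE.
  move=> t; apply: cvgD; first exact: cvg_cst.
  apply: cvgB; apply: cvgM; try exact: cvg_cst.
    exact: (continuous_comp (cl w t) (@continuous_cos R _)).
  exact: (continuous_comp (cl w t) (@continuous_sin R _)).
rewrite (@continuous_FTC2 _ _ F)//.
- rewrite -EFinB /F !mulr0 !mulr1 sin0 cos0 cosw sinw; congr EFin; ring.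
- exact: continuous_subspaceT.
- split=> [t _| |].
  + exact: ex_derive.
  + by apply: cvg_at_right_filter; exact: cF.
  + by apply: cvg_at_left_filter; exact: cF.
by move=> t _; rewrite derive1E; exact: derive_val.
Qed.

End orthogonality.

Section even_exponent.
Context {R : realType}.

Lemma conjcM (x y : R[i]) : conjc (x * y) = conjc x * conjc y.
Proof. exact: rmorphM. Qed.

Definition coef_monomial (G : {fset int}) (a : int -> R[i]) (k : nat)
    (phi : {ffun 'I_k -> G}) : R[i] :=
  \prod_i a (val i) ^+ mult phi i.

(** The frequency of the product of the monomial of [phi] by the conjugate of that of [psi]. *)
Definition spectral_gap (G : {fset int}) (k : nat) (phi psi : {ffun 'I_k -> G}) : int :=
  \sum_i ((mult phi i)%:Z - (mult psi i)%:Z) * val i.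

Lemma trig_mean_even (k : nat) (G : {fset int}) (a : int -> R[i]) :
  trig_mean (2 * k)%:R G a =
  \sum_(phi : {ffun 'I_k -> G}) \sum_(psi : {ffun 'I_k -> G})
    if spectral_gap phi psi == 0
    then complex.Re (coef_monomial a phi * conjc (coef_monomial a psi)) else 0.
Proof.
have expand t : normc (trig_poly G a (circle_param t)) `^ (2 * k)%:R =
    \sum_(phi : {ffun 'I_k -> G}) \sum_(psi : {ffun 'I_k -> G})
    complex.Re (coef_monomial a phi * conjc (coef_monomial a psi)
      * circle_param (t * (spectral_gap phi psi)%:~R)).
  rewrite powR_mulrn ?normc_ge0// exprM.
  set z := trig_poly _ _ _.
  have mon (phi : {ffun 'I_k -> G}) :
      \prod_i (a (val i) * circle_param (t * (val i)%:~R)) ^+ mult phi i =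
      coef_monomial a phi * circle_param (t * (\sum_i (mult phi i)%:Z * val i)%:~R).
    under eq_bigr do rewrite exprMn circle_paramXn.
    rewrite big_split /= -(big_morph (fun x : R => circle_param x)
      (@circle_paramD R) circle_param0).
    congr (_ * circle_param _); rewrite rmorph_sum mulr_sumr.
    by apply: eq_bigr => i _; rewrite rmorphM /= -pmulrn; ring.
  have zk : z ^+ k = \sum_(phi : {ffun 'I_k -> G}) coef_monomial a phi
      * circle_param (t * (\sum_i (mult phi i)%:Z * val i)%:~R).
    rewrite /z trig_poly_circle big_seq_fsetE /= exp_sum_mult.
    by apply: eq_bigr => phi _; exact: mon.
  (* An even exponent makes the power of the modulus a polynomial in [z] and its conjugate. *)
  transitivity (complex.Re (z ^+ k * conjc (z ^+ k))).
    by rewrite mul_conj_normc normcX /= -!exprM mulnC.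
  rewrite {2}zk rmorph_sum mulr_sumr zk.
  rewrite -(eq_bigr _ (fun psi _ => esym (mulr_suml _ _ _ _))) exchange_big /=.
  rewrite (raddf_sum (@complex.Re R)); apply: eq_bigr => phi _.
  rewrite (raddf_sum (@complex.Re R)); apply: eq_bigr => psi _.
  rewrite conjcM mulrACA (unimodular_conj (normc_circle_param _)).
  rewrite -circle_paramN -circle_paramD -mulrN -mulrDr -rmorphN -rmorphD /=.
  congr (complex.Re (_ * circle_param (_ * _%:~R))).
  by rewrite -sumrB; apply: eq_bigr => i _; rewrite mulrBl.
rewrite /trig_mean; under eq_fun do rewrite expand.
rewrite mean_sum => [|phi]; last by apply: bmeas_sum => psi; exact: bmeas_Re_circle.
apply: eq_bigr => phi _; rewrite mean_sum => [|psi]; last exact: bmeas_Re_circle.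
by apply: eq_bigr => psi _; exact: mean_Re_circle.
Qed.

(** The differences of multiplicities form a relation among the letters: they sum to 0 because both
    words have length [k], and their absolute values sum to at most [2 k]. Independence forbids it
    unless all differences vanish. *)
Lemma spectral_gap_injective (k : nat) (E : set int) (H G : {fset int}) :
  (forall (m : nat) (zeta r : 'I_m -> int), (1 <= m)%N ->
     zero_sum_le k zeta -> injective r -> (forall i, (E `\` [set` H]) (r i)) ->
     \sum_i zeta i * r i != 0) ->
  [set` G] `<=` E `\` [set` H] ->
  forall phi psi : {ffun 'I_k -> G}, spectral_gap phi psi = 0 ->
    mult phi =1 mult psi.
Proof.
move=> indep GE phi psi gap0.
(* Coefficients of a relation must be nonzero, so letters with equal multiplicities are
   discarded. *)
pose A := [pred i : G | mult phi i != mult psi i].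
have AE i : (i \in A) = (mult phi i != mult psi i) by [].
pose zeta (l : 'I_#|A|) : int := (mult phi (enum_val l))%:Z - (mult psi (enum_val l))%:Z.
pose r (l : 'I_#|A|) : int := val (enum_val l).
have sumA (f : G -> int) : (forall i, mult phi i = mult psi i -> f i = 0) ->
    \sum_i f i = \sum_l f (enum_val (A := A) l).
  move=> f0; rewrite -[RHS](big_enum_val f) [RHS]big_mkcond /=.
  by apply: eq_bigr => i _; case: ifPn => //; rewrite AE negbK => /eqP/f0.
have [A0|A0] := posnP #|A|.
  by move=> i; have /card0_eq/(_ i)/negbT := A0; rewrite AE negbK => /eqP.
have := indep #|A| zeta r A0; move=> /(_ _ _ _)/negP; case=> //.
- split; first split.
  + by move=> l; have := enum_valP l; rewrite AE /zeta subr_eq0 eqz_nat.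
  + rewrite -(sumA (fun i => (mult phi i)%:Z - (mult psi i)%:Z)).
      by rewrite sumrB -!(big_morph Posz PoszD (erefl _)) !sum_mult subrr.
    by move=> i ->; rewrite subrr.
  + apply: (@leq_trans (\sum_l (mult phi (enum_val (A := A) l)
                              + mult psi (enum_val (A := A) l)))%N).
      by apply: leq_sum => l _; rewrite /zeta; lia.
    rewrite -(big_enum_val (fun i => mult phi i + mult psi i)%N).
    apply: (@leq_trans (\sum_i (mult phi i + mult psi i))%N).
      by rewrite [leqRHS](bigID A)/= leq_addr.
    by rewrite big_split /= !sum_mult; lia.
- by move=> l l' /val_inj/enum_val_inj.
- by move=> l; apply: GE; exact: (valP (enum_val l)).
apply/eqP; rewrite -[RHS]gap0 /spectral_gap.
rewrite (sumA (fun i => ((mult phi i)%:Z - (mult psi i)%:Z) * val i))//.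
by move=> i ->; rewrite subrr mul0r.
Qed.

(** In each surviving term both words have the same multiplicities, so the signs enter only through
    the squared modulus of a product of unimodular numbers. *)
Lemma almost_indep_one_uncond (E : set int) (k : nat) : (0 < k)%N ->
  almost_indep k E ->
  exists2 G : {fset int}, [set` G] `<=` E
    & one_uncond (Lp_circle (2 * k)%:R) (@complex_signs R) (E `\` [set` G]).
Proof.
move=> k0 [H HE indep]; exists H => // G a eps GE epsS.
have p0 : 0 <= (2 * k)%:R :> R by [].
suff E' : trig_mean (2 * k)%:R G (fun q => eps q * a q) = trig_mean (2 * k)%:R G a.
  rewrite mul1e (Lp_circle_trig_poly G _ p0) (Lp_circle_trig_poly G a p0).
  by rewrite -/(trig_mean _ _ _) E'.
rewrite !trig_mean_even.
apply: eq_bigr => phi _; apply: eq_bigr => psi _; case: eqP => // gap0.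
have mE := spectral_gap_injective indep GE gap0.
have split_eps (chi : {ffun 'I_k -> G}) : coef_monomial (fun q => eps q * a q) chi
    = coef_monomial eps chi * coef_monomial a chi.
  by rewrite /coef_monomial -big_split /=; apply: eq_bigr => i _; rewrite exprMn.
have same : coef_monomial eps psi = coef_monomial eps phi.
  by apply: eq_bigr => i _; rewrite mE.
have unit_eps : normc (coef_monomial eps phi) = 1.
  rewrite normc_prod big1// => i _; rewrite normcX.
  have : `|eps (val i)| = 1 by apply: epsS; exact: (valP i).
  by rewrite normc_def -normc_sqr sqrtr_sqr ger0_norm ?normc_ge0// => -[->]; rewrite expr1n.
by rewrite !split_eps same conjcM mulrACA mul_conj_normc unit_eps expr1n mul1r.
Qed.

End even_exponent.

(** * Comparison of the unconditionality properties and conclusion *)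

Lemma one_uncond_umbs (R : realType) (normX : (R[i] -> R[i]) -> \bar R)
    (S : set R[i]) (E : set int) (G : {fset int}) :
  one_uncond normX S (E `\` [set` G]) -> umbs normX S E.
Proof.
move=> oE eps eps0; exists G; apply: (@le_lt_trans _ _ 1%:E).
  by apply: ereal_inf_lbound; exists 1.
by rewrite lte_fin ltrDl.
Qed.

(** Fewer signs leave more admissible constants, so the infimum can only decrease. *)
Lemma umbs_subset (R : realType) (normX : (R[i] -> R[i]) -> \bar R)
    (S T : set R[i]) (E : set int) :
  S `<=` T -> umbs normX T E -> umbs normX S E.
Proof.
move=> ST uE eps /uE[F CF]; exists F; apply: le_lt_trans CF.
apply: ereal_inf_le_tmp => _ [C TC <-]; exists C => // G a e GE Se.
by apply: TC => // q /Se/ST.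
Qed.

Lemma real_signs_complex (R : realType) : @real_signs R `<=` @complex_signs R.
Proof. by move=> z [->|->]; rewrite /complex_signs /= ?normrN1 ?normr1. Qed.

Theorem theorem3p4p2 (R : realType) (E : set int) (p : R) (p1 : 1 <= p) :
  (forall k : nat, p = (2 * k)%:R ->
     [/\ umbs (Lp_circle p) (@real_signs R) E
           <-> umbs (Lp_circle p) (@complex_signs R) E,
         umbs (Lp_circle p) (@complex_signs R) E <-> almost_indep k E
       & almost_indep k E ->
         exists2 G : {fset int}, [set` G] `<=` E
           & one_uncond (Lp_circle p) (@complex_signs R) (E `\` [set` G])])
  /\
  ((forall k : nat, p <> (2 * k)%:R) ->
     umbs (Lp_circle p) (@real_signs R) E
       \/ umbs (Lp_circle p) (@complex_signs R) E ->
     almost_indep_infty E).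
Proof.
have p0 : 0 < p by lra.
have complex_real := @umbs_subset R (Lp_circle p) _ _ E (@real_signs_complex R).
split=> [k pk|pn uE n _].
  have k0 : (0 < k)%N.
    by move: p0; rewrite pk ltr0n muln_gt0.
  have real_indep : umbs (Lp_circle p) (@real_signs R) E -> almost_indep k E.
    (* Only even integers smaller than [p = 2 k] have to be avoided. *)
    apply: umbs_almost_indep => // l lk; rewrite pk => /eqP.
    rewrite eqr_nat; lia.
  have indep_one : almost_indep k E -> exists2 G : {fset int}, [set` G] `<=` E
      & one_uncond (Lp_circle p) (@complex_signs R) (E `\` [set` G]).
    by rewrite pk; exact: almost_indep_one_uncond.
  have indep_complex : almost_indep k E -> umbs (Lp_circle p) (@complex_signs R) E.
    by case/indep_one => G _; exact: one_uncond_umbs.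
  split=> //; split=> //; first by move/real_indep.
  by move/complex_real.
apply: (umbs_almost_indep p0) => [l _|]; first exact: pn.
by case: uE => // /complex_real.
Qed.
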